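(* Let $\mathfrak n_{3,4}=\mathfrak z\oplus\mathfrak v$ be the pseudo $H$-type Lie algebra with centre $\mathfrak z=\mathbb R^{3,4}$ and $\mathfrak v\cong\mathbb R^{4,4}$ a minimal admissible ($8$-dimensional) module of $\operatorname{Cl}(\mathbb R^{3,4})$, let $\mathbf V=J(\mathfrak z)=\{J_Z: Z\in\mathfrak z\}\subset\mathfrak{so}(\mathfrak v)\cong\mathfrak{so}(4,4)$, and let $\mathbf N$ be the normalizer of $\mathbf V$ in $\mathfrak{so}(4,4)$, which here equals $[\mathbf V,\mathbf V]$. For any $Z\in\mathbf V$ and for any $Y\in\mathbb R^{4,4}$, it is possible to find $B\in\mathbf N=[\mathbf V,\mathbf V]$ such that $[B,Z]=0$ and $B(Y)=Z(Y)$. Hence, $N_{3,4}$ is a pseudo-Riemannian geodesic orbit nilmanifold.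
   Context: A scalar product is a non-degenerate symmetric bilinear form. $\mathbb R^{r,s}$ is $\mathbb R^{r+s}$ with $\langle Z,W\rangle_{r,s}=\sum_{i=1}^r z_iw_i-\sum_{j=1}^s z_{r+j}w_{r+j}$. Admissible module of $\operatorname{Cl}(\mathbb R^{r,s})$: a representation $J\colon\operatorname{Cl}(\mathbb R^{r,s})\to\operatorname{End}(\mathfrak v)$ (so $J_Z^2=-\langle Z,Z\rangle_{r,s}\operatorname{Id}$ for $Z\in\mathbb R^{r,s}$) with a scalar product $\langle\cdot,\cdot\rangle_{\mathfrak v}$ such that all $J_Z$ are skew-symmetric; minimal admissible means of smallest dimension among non-zero admissible modules. Pseudo $H$-type Lie algebra $\mathfrak n_{r,s}=\mathfrak z\oplus\mathfrak v$: orthogonal sum of $\mathfrak z=\mathbb R^{r,s}$ (central) and an admissible module $\mathfrak v$, with bracket $\mathfrak v\times\mathfrak v\to\mathfrak z$ given by $\langle J_Z(X),Y\rangle_{\mathfrak v}=\langle[X,Y],Z\rangle_{r,s}$. $N_{r,s}$ is the connected simply connected Lie group of $\mathfrak n_{r,s}$ with the left-invariant metric defined by $\langle\cdot,\cdot\rangle_{r,s}+\langle\cdot,\cdot\rangle_{\mathfrak v}$. $[\mathbf V,\mathbf V]$ denotes the linear span of commutators of elements of $\mathbf V$. Geodesic orbit: with $H=\{(\varphi,\psi)\in O(\mathfrak z)\times O(\mathfrak v)\mid\psi J_Z\psi^{-1}=J_{\varphi(Z)}\ \forall Z\}$, $G=N_{r,s}\rtimes H$ (the isometry group used by the paper) and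 $\mathfrak h=\{(C,A)\in\mathfrak{so}(\mathfrak z)\times\mathfrak{so}(\mathfrak v)\mid[A,J_Z]=J_{C(Z)}\ \forall Z\}$, $N_{r,s}$ is geodesic orbit if every geodesic through the identity is (up to reparametrization) an orbit of a one-parameter subgroup of $G$; equivalently, for all $Z\in\mathfrak z$, $X\in\mathfrak v$ there are $(C,A)\in\mathfrak h$ and $k\in\mathbb R$ with $(C+k\operatorname{Id})Z=0$ and $(A+k\operatorname{Id})X=J_Z(X)$. *)

(* Defs.v *)
From HB Require Import structures.
From mathcomp Require Import all_boot all_order all_algebra.
From mathcomp Require Import all_classical all_reals all_analysis.
Set Implicit Arguments.
Unset Strict Implicit.
Unset Printing Implicit Defensive.
Import Order.TTheory GRing.Theory Num.Theory.
Import numFieldNormedType.Exports.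
Local Open Scope classical_set_scope.
Local Open Scope ring_scope.

Definition sprs (R : realType) (r s : nat) (Z W : 'cV[R]_(r + s)) : R :=
  \sum_(i < r) Z (lshift s i) 0 * W (lshift s i) 0
  - \sum_(j < s) Z (rshift r j) 0 * W (rshift r j) 0.

(* A bilinear form on R^n is given by its Gram matrix g. *)
Definition bform (R : realType) (n : nat) (g : 'M[R]_n) (X Y : 'cV[R]_n) : R :=
  (X^T *m g *m Y) 0 0.

Definition scalar_product (R : realType) (n : nat) (g : 'M[R]_n) : Prop :=
  (forall X Y, bform g X Y = bform g Y X) /\
  (forall X, (forall Y, bform g X Y = 0) -> X = 0).

(* (R^n, g) is isometric to R^{p,q}; bijectivity of P forces n = p + q. *)
Definition isometric_to_Rpq (R : realType) (p q n : nat) (g : 'M[R]_n) : Prop :=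
  exists P : 'M[R]_(n, p + q),
    bijective (fun Z : 'cV[R]_(p + q) => P *m Z) /\
    (forall Z W : 'cV[R]_(p + q), bform g (P *m Z) (P *m W) = sprs Z W).

(* By the universal property of Cl(R^{r,s}), its representations on R^n are
   exactly the linear maps J satisfying the Clifford relation below. *)
Definition admissible (R : realType) (r s n : nat)
    (J : {linear 'cV[R]_(r + s) -> 'M[R]_n}) (g : 'M[R]_n) : Prop :=
  [/\ scalar_product g,
      forall Z, J Z *m J Z = (- sprs Z Z)%:M
    & forall Z X Y, bform g (J Z *m X) Y = - bform g X (J Z *m Y)].

Definition minimal_admissible (R : realType) (r s n : nat)
    (J : {linear 'cV[R]_(r + s) -> 'M[R]_n}) (g : 'M[R]_n) : Prop :=
  [/\ (0 < n)%N, admissible J g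
    & forall (m : nat) (J' : {linear 'cV[R]_(r + s) -> 'M[R]_m})
        (g' : 'M[R]_m), (0 < m)%N -> admissible J' g' -> (n <= m)%N].

Definition lie_mx (R : realType) (n : nat) (A B : 'M[R]_n) : 'M[R]_n :=
  A *m B - B *m A.

Definition so_form (R : realType) (n : nat) (g : 'M[R]_n) : set 'M[R]_n :=
  [set A | forall X Y, bform g (A *m X) Y = - bform g X (A *m Y)].

Definition linear_span (R : realType) (n : nat) (S : set 'M[R]_n) :
    set 'M[R]_n :=
  [set B | exists (k : nat) (a : 'I_k -> R) (F : 'I_k -> 'M[R]_n),
     (forall i, S (F i)) /\ B = \sum_(i < k) a i *: F i].

Definition commutator_span (R : realType) (n : nat) (V : set 'M[R]_n) :
    set 'M[R]_n :=
  linear_span [set lie_mx A B | A in V & B in V].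

Definition so_normalizer (R : realType) (n : nat) (g : 'M[R]_n)
    (V : set 'M[R]_n) : set 'M[R]_n :=
  [set B | so_form g B /\ (forall A, V A -> V (lie_mx B A))].

(* Coefficients of [X, Y] in the standard (pseudo-orthonormal) basis e_i of
   R^{r,s}; see [bracketE] for the defining property. *)
Definition bracket (R : realType) (r s n : nat)
    (J : {linear 'cV[R]_(r + s) -> 'M[R]_n}) (g : 'M[R]_n)
    (X Y : 'cV[R]_n) : 'cV[R]_(r + s) :=
  \col_i (let e : 'cV[R]_(r + s) := delta_mx i 0 in
          sprs e e * bform g (J e *m X) Y).

Lemma sprs_delta (R : realType) (r s : nat) (i : 'I_(r + s)) :
  sprs (delta_mx i 0 : 'cV[R]_(r + s)) (delta_mx i 0)
  = if (i < r)%N then 1 else -1.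
Proof.
rewrite /sprs; case: (split_ordP i) => k -> /=.
- rewrite (bigD1 k) //= !mxE !eqxx mul1r !big1 ?addr0 ?subr0 //.
  + by move=> m _; rewrite !mxE eq_rlshift mul0r.
  + by move=> m mk; rewrite !mxE (inj_eq (@lshift_inj _ _)) (negbTE mk) mul0r.
- rewrite big1 ?sub0r; last first.
    by move=> m _; rewrite !mxE eq_lrshift mul0r.
  rewrite (bigD1 k) //= !mxE !eqxx mul1r big1 ?addr0 //.
  by move=> m mk; rewrite !mxE (inj_eq (@rshift_inj _ _)) (negbTE mk) mul0r.
Qed.

Lemma bracketE (R : realType) (r s n : nat)
    (J : {linear 'cV[R]_(r + s) -> 'M[R]_n}) (g : 'M[R]_n)
    (Z : 'cV[R]_(r + s)) (X Y : 'cV[R]_n) :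
  bform g (J Z *m X) Y = sprs (bracket J g X Y) Z.
Proof.
have -> : bform g (J Z *m X) Y
    = \sum_i Z i 0 * bform g (J (delta_mx i 0) *m X) Y.
  rewrite [in LHS](matrix_sum_delta Z) linear_sum.
  rewrite /bform mulmx_suml linear_sum !mulmx_suml summxE.
  apply: eq_bigr => i _; rewrite big_ord1 linearZ /=.
  by rewrite -scalemxAl linearZ /= -!scalemxAl mxE.
rewrite /sprs big_split_ord /= -sumrN; congr (_ + _); apply: eq_bigr => i _.
- by rewrite mxE /= sprs_delta /= ltn_ord mul1r mulrC.
- by rewrite mxE /= sprs_delta /= ltnNge leq_addr /= !mulN1r mulNr opprK mulrC.
Qed.

(* Points of N_{r,s}, and tangent vectors at any of its points: N_{r,s} is
   z (+) v in exponential coordinates, with the Baker-Campbell-Hausdorff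
   product, which stops at the first bracket as the algebra is 2-step. *)
Definition nspace (R : realType) (r s n : nat) : lmodType R :=
  ('cV[R]_(r + s) * 'cV[R]_n)%type.

Definition nmul (R : realType) (r s n : nat)
    (J : {linear 'cV[R]_(r + s) -> 'M[R]_n}) (g : 'M[R]_n)
    (p q : nspace R r s n) : nspace R r s n :=
  (p.1 + q.1 + 2^-1 *: bracket J g p.2 q.2, p.2 + q.2).

Definition ninv (R : realType) (r s n : nat) (p : nspace R r s n) :
  nspace R r s n := (- p.1, - p.2).

Definition velocity (R : realType) (r s n : nat) (c : R -> nspace R r s n)
    (t : R) : nspace R r s n :=
  (\col_i derive1 (fun u => (c u).1 i 0) t,
   \col_i derive1 (fun u => (c u).2 i 0) t).

Definition derivable_curve (R : realType) (r s n : nat)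
    (c : R -> nspace R r s n) (t : R) : Prop :=
  (forall i, derivable (fun u => (c u).1 i 0) t 1) /\
  (forall i, derivable (fun u => (c u).2 i 0) t 1).

(* The differential at p of the left translation by p^-1. *)
Definition left_triv (R : realType) (r s n : nat)
    (J : {linear 'cV[R]_(r + s) -> 'M[R]_n}) (g : 'M[R]_n)
    (p U : nspace R r s n) : nspace R r s n :=
  velocity (fun t => nmul J g (ninv p) (p + t *: U)) 0.

Definition metric (R : realType) (r s n : nat)
    (J : {linear 'cV[R]_(r + s) -> 'M[R]_n}) (g : 'M[R]_n)
    (p U W : nspace R r s n) : R :=
  let U' := left_triv J g p U in let W' := left_triv J g p W in
  sprs U'.1 W'.1 + bform g U'.2 W'.2.

(* Derivative of p |-> metric p V W in the direction U (V, W constant). *)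
Definition dmetric (R : realType) (r s n : nat)
    (J : {linear 'cV[R]_(r + s) -> 'M[R]_n}) (g : 'M[R]_n)
    (p U V W : nspace R r s n) : R :=
  derive1 (fun t : R => metric J g (p + t *: U) V W) 0.

(* Koszul formula for <nabla_U V, W> at p, where U, V, W are constant vector
   fields (so that they commute): the Christoffel symbols of the first kind. *)
Definition christoffel (R : realType) (r s n : nat)
    (J : {linear 'cV[R]_(r + s) -> 'M[R]_n}) (g : 'M[R]_n)
    (p U V W : nspace R r s n) : R :=
  2^-1 * (dmetric J g p U V W + dmetric J g p V U W - dmetric J g p W U V).

Definition open_interval (R : realType) (I : set R) : Prop :=
  open I /\ is_interval I.

(* c is a geodesic on I: the covariant derivative of its velocity is
   orthogonal to every W, that is, it vanishes. *)
Definition geodesic_on (R : realType) (r s n : nat)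
    (J : {linear 'cV[R]_(r + s) -> 'M[R]_n}) (g : 'M[R]_n)
    (I : set R) (c : R -> nspace R r s n) : Prop :=
  forall t, I t ->
    [/\ derivable_curve c t, derivable_curve (velocity c) t
      & forall W, metric J g (c t) (velocity (velocity c) t) W
          + christoffel J g (c t) (velocity c t) (velocity c t) W = 0].

Definition maximal_geodesic (R : realType) (r s n : nat)
    (J : {linear 'cV[R]_(r + s) -> 'M[R]_n}) (g : 'M[R]_n)
    (I : set R) (c : R -> nspace R r s n) : Prop :=
  [/\ open_interval I, geodesic_on J g I c
    & forall (I' : set R) (c' : R -> nspace R r s n),
        open_interval I' -> geodesic_on J g I' c' -> I `<=` I' ->
        (forall t, I t -> c' t = c t) -> I' `<=` I].

Definition Hgroup (R : realType) (r s n : nat)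
    (J : {linear 'cV[R]_(r + s) -> 'M[R]_n}) (g : 'M[R]_n) :
    set ('M[R]_(r + s) * 'M[R]_n) :=
  [set h | [/\ h.1 \in unitmx, h.2 \in unitmx,
      forall Z W : 'cV[R]_(r + s), sprs (h.1 *m Z) (h.1 *m W) = sprs Z W,
      forall X Y, bform g (h.2 *m X) (h.2 *m Y) = bform g X Y
    & forall Z, h.2 *m J Z *m invmx h.2 = J (h.1 *m Z)]].

(* By the last condition in [Hgroup], this is an action by automorphisms of
   N_{r,s}, so that [Gmul] is the semidirect product law. *)
Definition Hact (R : realType) (r s n : nat) (h : 'M[R]_(r + s) * 'M[R]_n)
    (p : nspace R r s n) : nspace R r s n :=
  (h.1 *m p.1, h.2 *m p.2).

Definition Gspace (R : realType) (r s n : nat) : Type :=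
  (nspace R r s n * ('M[R]_(r + s) * 'M[R]_n))%type.

Definition Gmul (R : realType) (r s n : nat)
    (J : {linear 'cV[R]_(r + s) -> 'M[R]_n}) (g : 'M[R]_n)
    (a b : Gspace R r s n) : Gspace R r s n :=
  (nmul J g a.1 (Hact a.2 b.1), (a.2.1 *m b.2.1, a.2.2 *m b.2.2)).

Definition Gact (R : realType) (r s n : nat)
    (J : {linear 'cV[R]_(r + s) -> 'M[R]_n}) (g : 'M[R]_n)
    (a : Gspace R r s n) (p : nspace R r s n) : nspace R r s n :=
  nmul J g a.1 (Hact a.2 p).

Definition one_parameter_subgroup (R : realType) (r s n : nat)
    (J : {linear 'cV[R]_(r + s) -> 'M[R]_n}) (g : 'M[R]_n)
    (a : R -> Gspace R r s n) : Prop :=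
  [/\ forall t, Hgroup J g (a t).2,
      forall t u, a (t + u) = Gmul J g (a t) (a u),
      (forall i, continuous (fun t => (a t).1.1 i 0 : R)) /\
      (forall i, continuous (fun t => (a t).1.2 i 0 : R))
    & (forall i j, continuous (fun t => (a t).2.1 i j : R)) /\
      (forall i j, continuous (fun t => (a t).2.2 i j : R))].

(* A diffeomorphism from R onto an open interval, fixing 0. *)
Definition reparametrization (R : realType) (phi : R -> R) : Prop :=
  [/\ forall k t, derivable (derive1n k phi) t 1,
      forall t, 0 < derive1 phi t
    & phi 0 = 0].

(* The orbit of the identity under the one-parameter subgroup is allowed to
   cover only part of the maximal geodesic: this happens when phi is not onto
   (k <> 0 in the geodesic lemma, a typically pseudo-Riemannian feature). *)
Definition geodesic_orbit (R : realType) (r s n : nat)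
    (J : {linear 'cV[R]_(r + s) -> 'M[R]_n}) (g : 'M[R]_n) : Prop :=
  forall (I : set R) (c : R -> nspace R r s n),
    maximal_geodesic J g I c -> I 0 -> c 0 = 0 ->
    exists (a : R -> Gspace R r s n) (phi : R -> R),
      [/\ one_parameter_subgroup J g a, reparametrization phi
        & forall t, I (phi t) /\ c (phi t) = Gact J g (a t) 0].

(* Main.v *)
Require Import Defs.
From HB Require Import structures.
From mathcomp Require Import all_boot all_order all_algebra.
From mathcomp Require Import all_classical all_reals all_analysis.
From mathcomp Require Import ring lra.
Import Order.TTheory GRing.Theory Num.Theory.
Import numFieldNormedType.Exports.
Local Open Scope classical_set_scope.
Local Open Scope ring_scope.
Set Implicit Arguments.
Unset Strict Implicit.
Unset Printing Implicit Defensive.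

(** Linear algebra. An admissible module of Cl(R^{3,4}) has dimension at least
    8: if <X,X> = 1, then X, J_1 X, ..., J_7 X are orthogonal with squared norms
    +1 (four times) and -1 (four times), because every J_i J_j with i != j is
    skew ([frame_isometry]). Left multiplication by imaginary split octonions
    is an admissible module of dimension 8 ([octonion_admissible]). Hence a
    minimal module has dimension exactly 8, and the frame above identifies it
    with R^{4,4}.

    In dimension 8 the 7 + 21 operators J_i and J_i J_j (i < j) are skew and
    orthogonal for the trace form. As many pairs i < j index the entries above
    the diagonal that determine a skew operator, so these operators span so(v)
    ([so_bivector_span]). Thus so(v) is the direct sum of V = J(z) and [V,V],
    and [V,V] consists of the skew operators that are trace-orthogonal to V
    ([trace0_commutator]). An element of the normalizer is trace-orthogonal to
    V, so that the normalizer is [V,V] ([normalizer_commutator]).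

    The operator B. Given Z, X and Y, let K be the symmetric operator
    U |-> <X,U> Y + <Y,U> X. The operator
    B = J_Z K + K J_Z - 1/2 <X,Y> J_Z ([compensator]) is skew, it commutes with
    J_Z because J_Z^2 is a scalar, and the factor 1/2 makes it trace-orthogonal
    to V, which puts it in [V,V]. Moreover
    B Y = 1/2 <X,Y> J_Z Y + <Y,Y> J_Z X + <X,J_Z Y> Y, and a suitable X, which
    is a multiple of Y when Y is not null, turns the right-hand side into J_Z Y
    ([centralizer_action]).

    Geodesics. In exponential coordinates a geodesic (z(t), x(t)) from the
    identity with initial velocity (Z, X) is characterized by
    z' - 1/2 [x,x'] = Z and x'' = J_Z x' ([geodesic_equation]). Take B as above
    with B X = J_Z X, and let C be the skew map of z with [B,J_W] = J_{C W}, so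
    that C Z = 0. As B commutes with J_Z, exp(tB) X solves the same linear
    equation as x', hence x' = exp(tB) X, and the curve
    t |-> ((z(t), x(t)), (exp(tC), exp(tB))) is a one-parameter subgroup whose
    orbit of the identity is the geodesic, with its own affine parameter
    ([isotropy_geodesic_orbit]). *)

(** * Derivatives and exponentials of matrix-valued curves *)

(** Entrywise derivatives: they make sense for matrices of any size, including
    empty ones, and they are the derivatives that velocities of curves use. *)
Definition mxderive (R : realType) (m n : nat) (F : R -> 'M[R]_(m, n)) (t : R)
    (D : 'M[R]_(m, n)) : Prop :=
  forall i j, is_derive t (1 : R) (fun u => F u i j) (D i j).

(** The mean value theorem, on an interval that may be open or unbounded: this
    is the form that the domain of a geodesic calls for. *)
Lemma is_derive_zero_interval (R : realType) (I : set R) (f : R -> R) :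
  is_interval I -> (forall t, I t -> is_derive t (1 : R) f 0) ->
  forall s t, I s -> I t -> f s = f t.
Proof.
move=> Iitv df s t; wlog st : s t / s <= t.
  by move=> H Is It; case: (leP s t) => [/H->//|/ltW/H ->].
move=> Is It; rewrite -(subKr (f t) (f s)).
have Ist x : x \in `[s, t] -> I x.
  by rewrite in_itv => /= xst; apply: (Iitv s t).
have [||? _] := @MVT_segment _ f (cst 0) s t st.
- by move=> x /subset_itv_oo_cc/Ist/df.
- apply: derivable_within_continuous => x /Ist/df dfx.
  exact: ex_derive.
- by rewrite mul0r => ->; rewrite subr0.
Qed.

Section MatrixDerivative.
Variable R : realType.

Lemma mxderive_eq m n (F G : R -> 'M[R]_(m, n)) t D D' :
  mxderive F t D -> F =1 G -> D = D' -> mxderive G t D'.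
Proof. by move=> dF FG <-; rewrite -(funext FG). Qed.

Lemma mxderive_cst m n (A : 'M[R]_(m, n)) t : mxderive (fun=> A) t 0.
Proof. by move=> i j; rewrite mxE; exact: is_derive_cst. Qed.

Lemma mxderiveD m n (F G : R -> 'M[R]_(m, n)) t D D' :
  mxderive F t D -> mxderive G t D' -> mxderive (fun u => F u + G u) t (D + D').
Proof.
move=> dF dG i j; rewrite mxE.
have -> : (fun u => (F u + G u) i j) = (fun u => F u i j) + (fun u => G u i j).
  by apply/funext => u; rewrite mxE.
exact: is_deriveD.
Qed.

Lemma mxderiveM m n p (F : R -> 'M[R]_(m, n)) (G : R -> 'M[R]_(n, p)) t D D' :
  mxderive F t D -> mxderive G t D' ->
  mxderive (fun u => F u *m G u) t (D *m G t + F t *m D').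
Proof.
move=> dF dG i j; rewrite !mxE -big_split /=.
have -> : (fun u => (F u *m G u) i j)
    = \sum_(k < n) ((fun u => F u i k) * (fun u => G u k j)).
  by apply/funext => u; rewrite mxE fct_sumE.
apply: is_derive_sum => k.
apply: is_derive_eq; first by apply: is_deriveM; [exact: dF|exact: dG].
by rewrite /GRing.scale /= addrC; congr (_ + _); rewrite mulrC.
Qed.

Lemma mxderiveMl m n p (A : 'M[R]_(m, n)) (G : R -> 'M[R]_(n, p)) t D :
  mxderive G t D -> mxderive (fun u => A *m G u) t (A *m D).
Proof.
move=> dG; apply: mxderive_eq (mxderiveM (mxderive_cst A t) dG) _ _ => //.
by rewrite mul0mx add0r.
Qed.

Lemma mxderiveMr m n p (F : R -> 'M[R]_(m, n)) (A : 'M[R]_(n, p)) t D :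
  mxderive F t D -> mxderive (fun u => F u *m A) t (D *m A).
Proof.
move=> dF; apply: mxderive_eq (mxderiveM dF (mxderive_cst A t)) _ _ => //.
by rewrite mulmx0 addr0.
Qed.

Lemma mxderiveZ m n (f : R -> R) (F : R -> 'M[R]_(m, n)) t d D :
  is_derive t (1 : R) f d -> mxderive F t D ->
  mxderive (fun u => f u *: F u) t (d *: F t + f t *: D).
Proof.
move=> df dF i j; rewrite !mxE.
have -> : (fun u => (f u *: F u) i j) = f * (fun u => F u i j).
  by apply/funext => u; rewrite mxE.
apply: is_derive_eq; first by apply: is_deriveM; exact: dF.
by rewrite /GRing.scale /= addrC; congr (_ + _); rewrite mulrC.
Qed.

Lemma mxderiveZl m n (a : R) (F : R -> 'M[R]_(m, n)) t D :
  mxderive F t D -> mxderive (fun u => a *: F u) t (a *: D).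
Proof.
have da : is_derive t (1 : R) (fun=> a) 0 by exact: is_derive_cst.
move=> dF; apply: (mxderive_eq (mxderiveZ da dF)) => //.
by rewrite scale0r add0r.
Qed.

Lemma mxderiveZr m n (f : R -> R) (A : 'M[R]_(m, n)) t d :
  is_derive t (1 : R) f d -> mxderive (fun u => f u *: A) t (d *: A).
Proof.
move=> df; apply: (mxderive_eq (mxderiveZ df (mxderive_cst A t))) => //.
by rewrite scaler0 addr0.
Qed.

Lemma mxderiveN m n (F : R -> 'M[R]_(m, n)) t D :
  mxderive F t D -> mxderive (fun u => - F u) t (- D).
Proof.
move=> dF; apply: mxderive_eq (mxderiveZl (-1) dF) _ _ => [u|];
by rewrite scaleN1r.
Qed.

Lemma mxderiveB m n (F G : R -> 'M[R]_(m, n)) t D D' :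
  mxderive F t D -> mxderive G t D' -> mxderive (fun u => F u - G u) t (D - D').
Proof. by move=> dF dG; exact/mxderiveD/mxderiveN. Qed.

Lemma mxderive_tr m n (F : R -> 'M[R]_(m, n)) t D :
  mxderive F t D -> mxderive (fun u => (F u)^T) t D^T.
Proof.
move=> dF i j; rewrite mxE.
have -> : (fun u => (F u)^T i j) = (fun u => F u j i).
  by apply/funext => u; rewrite mxE.
exact: dF.
Qed.

Lemma mxderive_comp m n (F : R -> 'M[R]_(m, n)) (f : R -> R) t d D :
  mxderive F (f t) D -> is_derive t (1 : R) f d ->
  mxderive (fun u => F (f u)) t (d *: D).
Proof.
move=> dF df i j; rewrite mxE mulrC.
by apply: (@is_derive1_comp _ (fun u => F u i j) f).
Qed.

Lemma mxderive_shift m n (F : R -> 'M[R]_(m, n)) a t D :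
  mxderive F (a + t) D -> mxderive (fun u => F (a + u)) t D.
Proof.
move=> dF; apply: (mxderive_eq (mxderive_comp (f := +%R a) (d := 1) dF _)) =>
  //.
  have -> : +%R a = shift a by apply/funext => u; rewrite /= addrC.
  exact: is_derive_shift.
by rewrite scale1r.
Qed.

Lemma mxderive_opp m n (F : R -> 'M[R]_(m, n)) t D :
  mxderive F (- t) D -> mxderive (fun u => F (- u)) t (- D).
Proof.
move=> dF; apply: (mxderive_eq (mxderive_comp (f := -%R) (d := -1) dF _)) => //.
by rewrite scaleN1r.
Qed.

Lemma mxderive_zero_interval (I : set R) m n (F : R -> 'M[R]_(m, n)) :
  is_interval I -> (forall t, I t -> mxderive F t 0) ->
  forall s t, I s -> I t -> F s = F t.
Proof.
move=> Iitv dF s t Is It; apply/matrixP => i j.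
apply: (is_derive_zero_interval (f := fun u => F u i j) Iitv) => // u Iu.
by have := dF u Iu i j; rewrite mxE.
Qed.

Lemma mxderive_continuous m n (F : R -> 'M[R]_(m, n)) i j :
  (forall t, exists D, mxderive F t D) -> continuous (fun t => F t i j : R).
Proof.
move=> dF t; apply/differentiable_continuous/derivable1_diffP.
by have [D /(_ i j) ?] := dF t; exact: ex_derive.
Qed.

End MatrixDerivative.

Section MatrixExponential.
Variables (R : realType) (n : nat) (A : 'M[R]_n).

(** The index [m] counts derivatives: differentiating the exponential series
    term by term shifts it by one ([expmx_coeff_diffs]), so that a single
    convergence statement serves the series and its first two derivatives. *)
Definition expmx_coeff (m : nat) (i j : 'I_n) (k : nat) : R :=
  (A ^+ (m + k)) i j / k`!%:R.

Definition expmx (t : R) : 'M[R]_n :=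
  \matrix_(i, j) limn (pseries (expmx_coeff 0 i j) t).

(** The sum of the absolute values of all entries is a submultiplicative bound,
    so it dominates the entries of the powers geometrically. *)
Lemma expmx_coeff_bound : exists2 M : R, 0 <= M &
  forall k i j, `|(A ^+ k) i j| <= M ^+ k.
Proof.
exists (\sum_i \sum_j `|A i j|); first by do 2 apply: sumr_ge0 => ? _.
elim=> [|k IH] i j.
  rewrite !expr0 mxE; case: eqP => _ /=; rewrite ?normr1 ?normr0 ?ler01 //.
rewrite exprS mxE (le_trans (ler_norm_sum _ _ _))// exprS.
apply: (@le_trans _ _ (\sum_l `|A i l| * (\sum_i \sum_j `|A i j|) ^+ k)).
  by apply: ler_sum => l _; rewrite normrM ler_wpM2l.
rewrite -mulr_suml ler_wpM2r//.
  by rewrite exprn_ge0//; do 2 apply: sumr_ge0 => ? _.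
rewrite [leRHS](bigD1 i)//= lerDl.
by do 2 apply: sumr_ge0 => ? _.
Qed.

Lemma expmx_coeff_cvg m i j t : cvgn (pseries (expmx_coeff m i j) t).
Proof.
have [M M0 HM] := expmx_coeff_bound.
apply: normed_cvg.
apply: (@series_le_cvg _ _ (M ^+ m *: exp_coeff (M * `|t|))) => [k|k|k|].
- exact: normr_ge0.
- by rewrite /= /GRing.scale/= mulr_ge0 ?exprn_ge0// exp_coeff_ge0// mulr_ge0.
- have -> : (M ^+ m *: exp_coeff (M * `|t|)) k = M ^+ (m + k) / k`!%:R * `|t|
    ^+ k.
    by rewrite fctE /exp_coeff /= exprMn exprD /GRing.scale /=; ring.
  rewrite /= /expmx_coeff !normrM normfV normrX normr_nat.
  by rewrite !ler_wpM2r ?exprn_ge0 ?invr_ge0.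
- by apply: is_cvg_seriesZ; exact: is_cvg_series_exp_coeff.
Qed.

Lemma expmx_coeff_diffs m i j :
  pseries_diffs (expmx_coeff m i j) = expmx_coeff m.+1 i j.
Proof.
apply/funext => k; rewrite /pseries_diffs /expmx_coeff factS natrM invfM addnS.
by rewrite mulrCA [X in _ * X]mulrA mulfV ?mul1r// pnatr_eq0.
Qed.

Lemma expmx_diff t i j :
  is_derive t (1 : R) (fun u => expmx u i j)
    (limn (pseries (expmx_coeff 1 i j) t)).
Proof.
have -> : (fun u => expmx u i j) = (fun u => limn
  (pseries (expmx_coeff 0 i j) u)).
  by apply/funext => u; rewrite mxE.
rewrite -expmx_coeff_diffs.
apply: (@pseries_snd_diffs _ _ (`|t| + 1)); rewrite ?expmx_coeff_diffs;
  try exact: expmx_coeff_cvg.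
by rewrite [ltRHS]ger0_norm ?addr_ge0// ltrDl.
Qed.

Lemma mxderive_expmxl t : mxderive expmx t (A *m expmx t).
Proof.
move=> i j; apply: is_derive_eq; first exact: expmx_diff.
apply/cvg_lim => //.
have -> : pseries (expmx_coeff 1 i j) t
    = (fun N => \sum_l A i l * pseries (expmx_coeff 0 l j) t N).
  apply/funext => N; rewrite /pseries /series /=.
  under [RHS]eq_bigr do rewrite mulr_sumr.
  rewrite exchange_big; apply: eq_bigr => k _ /=.
  rewrite /expmx_coeff add1n add0n exprS mxE !mulr_suml.
  by apply: eq_bigr => l _; rewrite !mulrA.
rewrite mxE; apply: cvg_big => [|l _]; first exact: add_continuous.
by apply: cvgMl_tmp; rewrite mxE; exact: expmx_coeff_cvg.
Qed.

Lemma mxderive_expmxr t : mxderive expmx t (expmx t *m A).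
Proof.
move=> i j; apply: is_derive_eq; first exact: expmx_diff.
apply/cvg_lim => //.
have -> : pseries (expmx_coeff 1 i j) t
    = (fun N => \sum_l pseries (expmx_coeff 0 i l) t N * A l j).
  apply/funext => N; rewrite /pseries /series /=.
  under [RHS]eq_bigr do rewrite mulr_suml.
  rewrite exchange_big; apply: eq_bigr => k _ /=.
  rewrite /expmx_coeff add1n add0n exprSr mxE !mulr_suml.
  apply: eq_bigr => l _; ring.
rewrite mxE; apply: cvg_big => [|l _]; first exact: add_continuous.
by apply: cvgMr_tmp; rewrite mxE; exact: expmx_coeff_cvg.
Qed.

Lemma expmx0 : expmx 0 = 1%:M.
Proof.
apply/matrixP => i j; rewrite mxE; apply/cvg_lim => //.
(* The partial sum of length 0 is 0 instead of the constant term. *)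
rewrite -(cvg_shiftn 1).
have -> : (fun k => pseries (expmx_coeff 0 i j) 0 (k + 1)%N) = cst
  ((1%:M : 'M[R]_n) i j).
  apply/funext => k; rewrite /pseries /series /= addn1 big_nat_recl//=.
  rewrite big1 => [|l _]; last by rewrite expr0n/= mulr0.
  by rewrite /expmx_coeff expr0 fact0 divr1 expr0 mulr1 addr0.
exact: cvg_cst.
Qed.

Lemma expmxNl t : expmx (- t) *m expmx t = 1%:M.
Proof.
have E := @mxderive_zero_interval R setT n n (fun u => expmx (- u) *m expmx u).
rewrite (E _ _ t 0)// ?oppr0 ?expmx0 ?mulmx1// => s _.
apply: mxderive_eq (mxderiveM (mxderive_opp (mxderive_expmxr _))
  (mxderive_expmxl s)) _ _ => //.
by rewrite mulNmx !mulmxA addNr.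
Qed.

Lemma expmxNr t : expmx t *m expmx (- t) = 1%:M.
Proof. by rewrite -{1}[t]opprK expmxNl. Qed.

(** Multiplying a solution of u' = A u by exp(-tA) gives a curve with zero
    derivative. *)
Lemma linear_ode_unique (I : set R) m (u : R -> 'M[R]_(n, m)) :
  is_interval I -> I 0 -> (forall t, I t -> mxderive u t (A *m u t)) ->
  forall t, I t -> u t = expmx t *m u 0.
Proof.
move=> Iitv I0 du t It.
have E := @mxderive_zero_interval R I n m (fun s => expmx (- s) *m u s) Iitv.
have <- : expmx (- t) *m u t = u 0.
  rewrite (E _ t 0)// ?oppr0 ?expmx0 ?mul1mx// => s Is.
  apply: mxderive_eq (mxderiveM (mxderive_opp (mxderive_expmxr _)) (du s Is)) _
    _ => //.
  by rewrite mulNmx !mulmxA addNr.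
by rewrite mulmxA expmxNr mul1mx.
Qed.

(** Both sides solve the same linear equation in one of the two times. *)
Lemma expmxD s t : expmx (s + t) = expmx s *m expmx t.
Proof.
rewrite addrC (@linear_ode_unique setT n (fun u => expmx (t + u))) ?addr0//.
by move=> u _; exact/mxderive_shift/mxderive_expmxl.
Qed.

End MatrixExponential.

(** * The geodesic equation of a pseudo H-type group *)

Section BilinearForm.
Variables (R : realType) (n : nat) (g : 'M[R]_n).
Implicit Types X Y : 'cV[R]_n.

Lemma bformDl X X' Y : bform g (X + X') Y = bform g X Y + bform g X' Y.
Proof. by rewrite /bform linearD /= !mulmxDl mxE. Qed.

Lemma bformDr X Y Y' : bform g X (Y + Y') = bform g X Y + bform g X Y'.
Proof. by rewrite /bform mulmxDr mxE. Qed.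

Lemma bformZl a X Y : bform g (a *: X) Y = a * bform g X Y.
Proof. by rewrite /bform linearZ /= -!scalemxAl mxE. Qed.

Lemma bformZr a X Y : bform g X (a *: Y) = a * bform g X Y.
Proof. by rewrite /bform -scalemxAr mxE. Qed.

Lemma bformNl X Y : bform g (- X) Y = - bform g X Y.
Proof. by rewrite -scaleN1r bformZl mulN1r. Qed.

Lemma bformNr X Y : bform g X (- Y) = - bform g X Y.
Proof. by rewrite -scaleN1r bformZr mulN1r. Qed.

Lemma bformBl X X' Y : bform g (X - X') Y = bform g X Y - bform g X' Y.
Proof. by rewrite bformDl bformNl. Qed.

Lemma bformBr X Y Y' : bform g X (Y - Y') = bform g X Y - bform g X Y'.
Proof. by rewrite bformDr bformNr. Qed.

Lemma bform0l Y : bform g 0 Y = 0.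
Proof. by rewrite -(scale0r 0) bformZl mul0r. Qed.

Lemma bform0r X : bform g X 0 = 0.
Proof. by rewrite -(scale0r 0) bformZr mul0r. Qed.

Lemma is_derive_bform (X Y : R -> 'cV[R]_n) t DX DY :
  mxderive X t DX -> mxderive Y t DY ->
  is_derive t (1 : R) (fun u => bform g (X u) (Y u))
    (bform g DX (Y t) + bform g (X t) DY).
Proof.
move=> dX dY.
have := mxderiveM (mxderiveMr g (mxderive_tr dX)) dY.
by move=> /(_ 0 0); rewrite mxE.
Qed.

End BilinearForm.

Section StandardForm.
Variables (R : realType) (r s : nat).
Implicit Types Z W : 'cV[R]_(r + s).

(** The diagonal of the Gram matrix of R^{r,s}. *)
Definition signature (i : 'I_(r + s)) : R := if (i < r)%N then 1 else -1.

Lemma signature_sqr i : signature i * signature i = 1.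
Proof. by rewrite /signature; case: ifP; rewrite ?mulr1 ?mulrNN ?mulr1. Qed.

Lemma sprs_bform Z W : sprs Z W = bform (diag_mx (\row_i signature i)) Z W.
Proof.
rewrite /bform mul_mx_diag !mxE big_split_ord /sprs /= -sumrN.
congr (_ + _); apply: eq_bigr => i _; rewrite !mxE /signature /=.
- by rewrite ltn_ord mulr1.
- by rewrite ltnNge leq_addr /= mulrN1 mulNr.
Qed.

Lemma sprsE Z W : sprs Z W = \sum_i signature i * Z i 0 * W i 0.
Proof.
rewrite sprs_bform /bform mul_mx_diag !mxE; apply: eq_bigr => i _.
by rewrite !mxE [_ * signature i]mulrC.
Qed.

Lemma sprsC Z W : sprs Z W = sprs W Z.
Proof. by rewrite !sprsE; apply: eq_bigr => i _; ring. Qed.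

Lemma sprs_deltar Z i : sprs Z (delta_mx i 0) = signature i * Z i 0.
Proof.
rewrite sprsE (bigD1 i) //= mxE !eqxx mulr1 big1 ?addr0// => j ji.
by rewrite mxE (negPf ji) mulr0.
Qed.

Lemma sprs_nondeg Z : (forall W, sprs Z W = 0) -> Z = 0.
Proof.
move=> H; apply/colP => i; rewrite mxE.
have := H (delta_mx i 0); rewrite sprs_deltar => /(congr1 ( *%R (signature i))).
by rewrite mulrA signature_sqr mul1r mulr0.
Qed.

End StandardForm.

Section PseudoH.
Variables (R : realType) (r s n : nat).
Variables (J : {linear 'cV[R]_(r + s) -> 'M[R]_n}) (g : 'M[R]_n).
Hypothesis adm : admissible J g.
Local Notation nsp := (nspace R r s n).
Local Notation br := (bracket J g).
Implicit Types (Z W : 'cV[R]_(r + s)) (X Y : 'cV[R]_n) (p U V : nsp).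

Lemma bformC X Y : bform g X Y = bform g Y X.
Proof. by case: adm => -[+ _] _ _; apply. Qed.

Lemma bform_nondeg X : (forall Y, bform g X Y = 0) -> X = 0.
Proof. by case: adm => -[_ +] _ _; apply. Qed.

Lemma J_sqr Z : J Z *m J Z = (- sprs Z Z)%:M.
Proof. by case: adm. Qed.

Lemma J_skew Z X Y : bform g (J Z *m X) Y = - bform g X (J Z *m Y).
Proof. by case: adm. Qed.

Lemma bracketDl X X' Y : br (X + X') Y = br X Y + br X' Y.
Proof. by apply/colP => i; rewrite !mxE /= mulmxDr bformDl mulrDr. Qed.

Lemma bracketDr X Y Y' : br X (Y + Y') = br X Y + br X Y'.
Proof. by apply/colP => i; rewrite !mxE /= bformDr mulrDr. Qed.

Lemma bracketZl a X Y : br (a *: X) Y = a *: br X Y.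
Proof. by apply/colP => i; rewrite !mxE /= -scalemxAr bformZl; ring. Qed.

Lemma bracketZr a X Y : br X (a *: Y) = a *: br X Y.
Proof. by apply/colP => i; rewrite !mxE /= bformZr; ring. Qed.

Lemma bracketNl X Y : br (- X) Y = - br X Y.
Proof. by rewrite -(scaleN1r X) bracketZl scaleN1r. Qed.

Lemma bracket0l Y : br 0 Y = 0.
Proof. by rewrite -(scale0r 0) bracketZl scale0r. Qed.

Lemma bracket0r X : br X 0 = 0.
Proof. by rewrite -(scale0r 0) bracketZr scale0r. Qed.

Lemma bracketC X Y : br X Y = - br Y X.
Proof.
by apply/colP => i; rewrite !mxE /= J_skew bformC mulrN.
Qed.

Lemma bracketXX X : br X X = 0.
Proof.
apply/colP => i; rewrite mxE.
by have /colP/(_ i) := bracketC X X; rewrite !mxE; lra.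
Qed.

Lemma mxderive_bracket (X Y : R -> 'cV[R]_n) t DX DY :
  mxderive X t DX -> mxderive Y t DY ->
  mxderive (fun u => br (X u) (Y u)) t (br DX (Y t) + br (X t) DY).
Proof.
move=> dX dY i j; rewrite (ord1 j) !mxE -mulrDr /=.
set e := delta_mx i 0.
have -> : (fun u => br (X u) (Y u) i 0)
   = (fun u => sprs e e *: bform g (J e *m X u) (Y u)).
  by apply/funext => u; rewrite !mxE.
by apply: is_deriveZ; apply: is_derive_bform => //; exact: mxderiveMl.
Qed.

Lemma velocityE (c : R -> nsp) t D1 D2 :
  mxderive (fun u => (c u).1) t D1 -> mxderive (fun u => (c u).2) t D2 ->
  velocity c t = (D1, D2).
Proof.
move=> d1 d2; rewrite /velocity; congr pair; apply/colP => i;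
  rewrite mxE derive1E.
- by have d := d1 i 0; exact: derive_val.
- by have d := d2 i 0; exact: derive_val.
Qed.

Lemma mxderive_derivable_curve (c : R -> nsp) t D1 D2 :
  mxderive (fun u => (c u).1) t D1 -> mxderive (fun u => (c u).2) t D2 ->
  derivable_curve c t.
Proof.
by move=> d1 d2; split=> i; [have := d1 i 0|have := d2 i 0] => d;
  exact: ex_derive.
Qed.

Lemma mxderive_velocity1 (c : R -> nsp) t : derivable_curve c t ->
  mxderive (fun u => (c u).1) t (velocity c t).1.
Proof.
move=> [d1 _] i j; rewrite (ord1 j) mxE derive1E.
by apply: DeriveDef => //; exact: d1.
Qed.

Lemma mxderive_velocity2 (c : R -> nsp) t : derivable_curve c t ->
  mxderive (fun u => (c u).2) t (velocity c t).2.
Proof.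
move=> [_ d2] i j; rewrite (ord1 j) mxE derive1E.
by apply: DeriveDef => //; exact: d2.
Qed.

Lemma mxderive_line m (X Y : 'cV[R]_m) t : mxderive (fun u : R => X + u *: Y) t
  Y.
Proof.
apply: mxderive_eq (mxderiveD (mxderive_cst X t)
  (mxderiveZr Y (is_derive_id t 1))) _ _ => //.
by rewrite add0r scale1r.
Qed.

(** The tangent vector [U] at [p], moved to the identity by the left
    translation by p^-1. *)
Definition left_translate (p U : nsp) : nsp := (U.1 - 2^-1 *: br p.2 U.2, U.2).

Lemma left_trivE p U : left_triv J g p U = left_translate p U.
Proof.
apply: velocityE => /=.
- have d1 := mxderive_line p.1 U.1 0; have d2 := mxderive_line p.2 U.2 0.
  apply: mxderive_eq (mxderiveD (mxderiveD (mxderive_cst (- p.1) 0) d1)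
    (mxderiveZl 2^-1 (mxderive_bracket (mxderive_cst (- p.2) 0) d2))) _ _ => //.
  by rewrite bracket0l !add0r bracketNl scalerN.
- apply: mxderive_eq (mxderiveD (mxderive_cst (- p.2) 0)
    (mxderive_line p.2 U.2 0)) _ _ => //.
  by rewrite add0r.
Qed.

Lemma metricE p U (W : nsp) : metric J g p U W =
  sprs (left_translate p U).1 (left_translate p W).1 + bform g U.2 W.2.
Proof. by rewrite /metric !left_trivE. Qed.

Lemma dmetricE p U V (W : nsp) : dmetric J g p U V W =
  - 2^-1 * sprs (br U.2 V.2) (left_translate p W).1 - 2^-1 * sprs
      (left_translate p V).1 (br U.2 W.2).
Proof.
rewrite /dmetric derive1E.
have dl V' : mxderive (fun t : R => (left_translate (p + t *: U) V').1) 0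
  (- 2^-1 *: br U.2 V'.2).
  apply: mxderive_eq (mxderiveB (mxderive_cst V'.1 0) (mxderiveZl 2^-1
    (mxderive_bracket (mxderive_line p.2 U.2 0) (mxderive_cst V'.2 0)))) _ _ =>
      //=.
  by rewrite bracket0r addr0 sub0r scaleNr.
have d := is_derive_bform (diag_mx (\row_i signature R i)) (dl V) (dl W).
have dc : is_derive (0 : R) (1 : R) (fun=> bform g V.2 W.2) 0 by exact:
  is_derive_cst.
have -> : (fun t : R => metric J g (p + t *: U) V W) =
  (fun t : R => bform (diag_mx (\row_i signature R i))
    (left_translate (p + t *: U) V).1 (left_translate (p + t *: U) W).1)
   + (fun=> bform g V.2 W.2).
  by apply/funext => t; rewrite metricE sprs_bform.
have dd := is_deriveD d dc; rewrite derive_val.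
rewrite addr0 -!sprs_bform !sprs_bform bformZl bformZr scale0r addr0.
by rewrite !mulNr.
Qed.

(** The bracket [U, U] vanishes, so only the terms with [U, W] survive in the
    Koszul formula, and the definition of the bracket turns them into J. *)
Lemma christoffelE p U (W : nsp) :
  christoffel J g p U U W = - bform g (J (left_translate p U).1 *m U.2) W.2.
Proof.
have s0 Z : sprs 0 Z = 0 by rewrite sprs_bform bform0l.
have sN Z Z' : sprs Z (- Z') = - sprs Z Z' by rewrite !sprs_bform bformNr.
rewrite /christoffel !dmetricE bracketXX s0 [br W.2 _]bracketC bracketE.
rewrite [sprs (- _) _]sprsC sN [sprs (br _ _) _]sprsC.
by field.
Qed.

(** Testing against the left-invariant fields with W in v gives the v-part of
    the equation, and testing against the central fields gives the z-part. *)
Lemma geodesic_equation p U A :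
  (forall W : nsp, metric J g p A W + christoffel J g p U U W = 0) <->
  A.1 = 2^-1 *: br p.2 A.2 /\ A.2 = J (left_translate p U).1 *m U.2.
Proof.
split=> [H|[H1 H2] W]; last first.
  rewrite metricE christoffelE /= H1 subrr -H2.
  by rewrite sprs_bform bform0l add0r subrr.
have E2 : A.2 = J (left_translate p U).1 *m U.2.
  apply/eqP; rewrite -subr_eq0; apply/eqP/bform_nondeg => Y.
  have := H (2^-1 *: br p.2 Y, Y).
  rewrite metricE christoffelE /= subrr sprs_bform bform0r add0r.
  by rewrite bformBl.
split=> //; apply/eqP; rewrite -subr_eq0; apply/eqP/sprs_nondeg => Z.
have := H (Z, 0).
by rewrite metricE christoffelE /= bracket0r scaler0 subr0 !bform0r oppr0
  !addr0.
Qed.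

End PseudoH.

(** * Geodesics that are orbits of one-parameter subgroups *)

(** These are the cosine and sine of frequency sqrt(lam) (hyperbolic when
    lam < 0, polynomial when lam = 0) followed by two successive primitives.
    Reading them off the exponential of one companion matrix treats the three
    signs of lam at once. *)
Lemma oscillator_exists (R : realType) (lam : R) : exists c s q w : R -> R,
  [/\ c 0 = 1, s 0 = 0, q 0 = 0 & w 0 = 0] /\
  forall t, [/\ is_derive t (1 : R) c (- lam * s t),
    is_derive t (1 : R) s (c t),
                is_derive t (1 : R) q (s t) & is_derive t (1 : R) w (q t)].
Proof.
pose M : 'M[R]_4 := \matrix_(i, j)
  nth 0 (nth [::] [:: [:: 0; - lam; 0; 0]; [:: 1; 0; 0; 0];
                      [:: 0; 1; 0; 0]; [:: 0; 0; 1; 0]] i) j.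
pose f t := expmx M t *m (delta_mx 0 0 : 'cV_4).
pose i0 : 'I_4 := ord0; pose i1 : 'I_4 := lift ord0 (ord0 : 'I_3).
pose i2 : 'I_4 := lift ord0 (lift ord0 (ord0 : 'I_2)).
pose i3 : 'I_4 := lift ord0 (lift ord0 (lift ord0 (ord0 : 'I_1))).
have df t i : is_derive t (1 : R) (fun u => f u i 0) ((M *m f t) i 0).
  by have := mxderiveMr (delta_mx 0 0 : 'cV_4) (mxderive_expmxl M t);
     rewrite -mulmxA => /(_ i 0).
exists (fun t => f t i0 0), (fun t => f t i1 0), (fun t => f t i2 0),
  (fun t => f t i3 0); split=> [|t].
  by rewrite /f expmx0 mul1mx !mxE.
split.
- apply: is_derive_eq (df t i0) _; rewrite mxE !big_ord_recl big_ord0 !mxE /=;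
    ring.
- apply: is_derive_eq (df t i1) _; rewrite mxE !big_ord_recl big_ord0 !mxE /=;
    ring.
- apply: is_derive_eq (df t i2) _; rewrite mxE !big_ord_recl big_ord0 !mxE /=;
    ring.
- apply: is_derive_eq (df t i3) _; rewrite mxE !big_ord_recl big_ord0 !mxE /=;
    ring.
Qed.

Section GeodesicOrbits.
Variables (R : realType) (r s n : nat).
Variables (J : {linear 'cV[R]_(r + s) -> 'M[R]_n}) (g : 'M[R]_n).
Hypothesis adm : admissible J g.
Local Notation nsp := (nspace R r s n).
Local Notation br := (bracket J g).

(** The derivative of <exp(tC) X, exp(tC) Y> vanishes when C is skew. *)
Lemma expmx_isometry m (G C : 'M[R]_m) t (X Y : 'cV[R]_m) :
  (forall X Y, bform G (C *m X) Y = - bform G X (C *m Y)) ->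
  bform G (expmx C t *m X) (expmx C t *m Y) = bform G X Y.
Proof.
move=> sk.
pose f u := bform G (expmx C u *m X) (expmx C u *m Y).
rewrite -/(f t) (@is_derive_zero_interval _ setT f _ _ t 0)//.
  by rewrite /f expmx0 !mul1mx.
move=> u _; apply: is_derive_eq.
  by apply: is_derive_bform; apply: mxderiveMr; exact: mxderive_expmxl.
by rewrite -!mulmxA sk addNr.
Qed.

(** Membership of (C, A) in the Lie algebra of the isotropy group
    [Hgroup]. *)
Definition isotropy_derivation (C : 'M[R]_(r + s)) (A : 'M[R]_n) : Prop :=
  [/\ forall Z W : 'cV[R]_(r + s), sprs (C *m Z) W = - sprs Z (C *m W),
      so_form g A & forall W, lie_mx A (J W) = J (C *m W)].

Lemma mxderive_J (Z : R -> 'cV[R]_(r + s)) t D :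
  mxderive Z t D -> mxderive (fun u => J (Z u)) t (J D).
Proof.
move=> dZ.
have JE (W : 'cV[R]_(r + s)) i j : J W i j = \sum_k W k 0 * J (delta_mx k 0) i
  j.
  rewrite [in LHS](matrix_sum_delta W) linear_sum summxE; apply: eq_bigr => k _.
  by rewrite big_ord1 linearZ mxE.
move=> i j; rewrite JE.
have -> : (fun u => J (Z u) i j)
    = (fun u => ((\row_k J (delta_mx k 0) i j) *m Z u) 0 0).
  by apply/funext => u; rewrite JE mxE; apply: eq_bigr => k _;
    rewrite mxE mulrC.
apply: is_derive_eq; first exact: (mxderiveMl _ dZ).
by rewrite mxE; apply: eq_bigr => k _; rewrite mxE mulrC.
Qed.

(** The relation [A, J_W] = J_{C W} says that exp(-tA) J_{exp(tC) Z} exp(tA)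
    does not depend on t. *)
Lemma expmx_Hgroup C A t : isotropy_derivation C A -> Hgroup J g
  (expmx C t, expmx A t).
Proof.
move=> [Csk Ask CA].
have E m (B : 'M[R]_m) : expmx B t \in unitmx.
  by case: (mulmx1_unit (expmxNr B t)).
split=> //=.
- move=> Z W; rewrite !sprs_bform; apply: expmx_isometry => {}Z {}W.
  by rewrite -!sprs_bform.
- by move=> X Y; exact: expmx_isometry.
move=> Z; suff <- : expmx A (- t) *m J (expmx C t *m Z) *m expmx A t = J Z.
  by rewrite !mulmxA expmxNr mul1mx mulmxK.
pose f u := expmx A (- u) *m J (expmx C u *m Z) *m expmx A u.
rewrite -/(f t) (@mxderive_zero_interval _ setT _ _ f _ _ t 0)//.
  by rewrite /f oppr0 !expmx0 !mul1mx mulmx1.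
move=> u _.
have dC := mxderive_J (mxderiveMr Z (mxderive_expmxl C u)).
have dA := mxderiveM (mxderive_opp (mxderive_expmxr A (- u))) dC.
apply: mxderive_eq (mxderiveM dA (mxderive_expmxl A u)) _ _ => //.
rewrite -[C *m _ *m Z]mulmxA -CA /lie_mx mulmxBr !mulmxDl !mulNmx !mulmxA.
by rewrite addrA addNr add0r addNr.
Qed.

Lemma Hgroup_bracket h (X Y : 'cV[R]_n) : Hgroup J g h ->
  br (h.2 *m X) (h.2 *m Y) = h.1 *m br X Y.
Proof.
case=> h1 h2 iso1 iso2 hJ; apply/eqP; rewrite -subr_eq0; apply/eqP.
apply: sprs_nondeg => W.
rewrite sprs_bform bformBl -!sprs_bform -(mulKVmx h1 W) iso1.
rewrite -!bracketE -hJ -!mulmxA mulKmx// iso2.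
by rewrite subrr.
Qed.

Variables (Z0 : 'cV[R]_(r + s)) (X0 : 'cV[R]_n).

(** The geodesic equation integrated once: Z0 = z' - 1/2 [x, x'] is conserved,
    and y = x' obeys a linear equation with constant coefficients. *)
Definition geodesic_flow (z : R -> 'cV[R]_(r + s)) (x y : R -> 'cV[R]_n) :
    Prop :=
  [/\ z 0 = 0, x 0 = 0 & y 0 = X0] /\
  forall t, [/\ mxderive x t (y t), mxderive y t (J Z0 *m y t)
              & mxderive z t (Z0 + 2^-1 *: br (x t) (y t))].

(** As J_{Z0}^2 is a scalar, y stays in the plane spanned by X0 and J_{Z0} X0,
    and [x, y] is a function times [X0, J_{Z0} X0], which is integrated
    explicitly. *)
Lemma geodesic_flow_exists : exists z x y, geodesic_flow z x y.
Proof.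
have [c [s' [q [w [[c0 s0 q0 w0] H]]]]] := oscillator_exists (sprs Z0 Z0).
set lam := sprs Z0 Z0 in H.
have E1 t : c t + lam * q t = 1.
  transitivity (c 0 + lam * q 0); last by rewrite c0 q0 mulr0 addr0.
  apply: (@is_derive_zero_interval _ setT (fun t => c t + lam * q t)) => // u _.
  have [dc _ dq _] := H u.
  have d := is_deriveD dc (is_deriveZ lam dq).
  by apply: (is_derive_eq d); rewrite /GRing.scale /=; ring.
(* In [x, y] the coefficient of [X0, J_{Z0} X0] is s^2 - q c, which is q. *)
have E2 t : s' t * s' t - q t * c t - q t = 0.
  transitivity (s' 0 * s' 0 - q 0 * c 0 - q 0); last by rewrite s0 q0; ring.
  apply: (@is_derive_zero_interval _ setT
    (fun t => s' t * s' t - q t * c t - q t)) => // u _.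
  have [dc ds dq _] := H u.
  have d := is_deriveB (is_deriveB (is_deriveM ds ds) (is_deriveM dq dc)) dq.
  apply: (is_derive_eq d).
  by rewrite /GRing.scale /=; have := E1 u; nra.
pose b := br X0 (J Z0 *m X0).
exists (fun t => t *: Z0 + (2^-1 * w t) *: b),
  (fun t => s' t *: X0 + q t *: (J Z0 *m X0)),
  (fun t => c t *: X0 + s' t *: (J Z0 *m X0)); split.
  by rewrite c0 s0 q0 w0 mulr0 !scale0r scale1r !addr0.
move=> t; have [dc ds dq dw] := H t; split.
- by apply: mxderiveD; exact: mxderiveZr.
- apply: mxderive_eq (mxderiveD (mxderiveZr X0 dc)
    (mxderiveZr (J Z0 *m X0) ds)) _ _ => //.
  rewrite mulmxDr -!scalemxAr mulmxA (J_sqr adm) -/lam mul_scalar_mx scalerA.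
  by rewrite mulrN mulNr [lam * _]mulrC addrC.
- have dw' : is_derive t (1 : R) (fun u => 2^-1 * w u) (2^-1 * q t).
    exact: is_deriveZ.
  apply: mxderive_eq (mxderiveD (mxderiveZr Z0 (is_derive_id t 1))
    (mxderiveZr b dw')) _ _ => //.
  rewrite scale1r -scalerA; congr (_ + _ *: _).
  rewrite !(bracketDl, bracketDr, bracketZl, bracketZr) !(bracketXX adm).
  rewrite [br (J Z0 *m X0) X0](bracketC adm) -/b !scaler0 add0r addr0 !scalerN.
  by rewrite !scalerA -scalerBl; congr (_ *: _); have := E2 t; lra.
Qed.

Variables (z : R -> 'cV[R]_(r + s)) (x y : R -> 'cV[R]_n).
Hypothesis flow : geodesic_flow z x y.

Let dx t : mxderive x t (y t). Proof. by case: flow => _ /(_ t)[]. Qed.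
Let dy t : mxderive y t (J Z0 *m y t). Proof. by case: flow => _ /(_ t)[]. Qed.
Let dz t : mxderive z t (Z0 + 2^-1 *: br (x t) (y t)).
Proof. by case: flow => _ /(_ t)[]. Qed.

Lemma flow_geodesic : geodesic_on J g setT (fun t => (z t, x t) : nsp).
Proof.
move=> t _.
have v1 : velocity (fun t => (z t, x t) : nsp)
    = fun t => (Z0 + 2^-1 *: br (x t) (y t), y t).
  by apply/funext => u; exact: velocityE.
have d2 : mxderive (fun t => Z0 + 2^-1 *: br (x t) (y t)) t
   (2^-1 *: br (x t) (J Z0 *m y t)).
  apply: mxderive_eq (mxderiveD (mxderive_cst Z0 t)
    (mxderiveZl 2^-1 (mxderive_bracket _ _ (dx t) (dy t)))) _ _ => //.
  by rewrite add0r (bracketXX adm) add0r.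
split.
- exact: (@mxderive_derivable_curve _ _ _ _ _ _ (Z0 + 2^-1 *: br (x t) (y t))
    (y t)).
- rewrite v1; exact: (mxderive_derivable_curve (c := fun t => (_, y t) : nsp)
    d2 (dy t)).
- apply/(geodesic_equation adm).
  have -> : velocity (velocity (fun t => (z t, x t) : nsp)) t
    = (2^-1 *: br (x t) (J Z0 *m y t), J Z0 *m y t).
    by rewrite v1; exact: velocityE.
  by rewrite v1 /left_translate /= addrK.
Qed.

(** Along a geodesic the conserved quantity equals Z0, so the velocity in v
    solves the linear equation of the flow; x and then z follow by
    integration. *)
Lemma geodesic_unique (I : set R) (c : R -> nsp) :
  is_interval I -> I 0 -> geodesic_on J g I c -> c 0 = 0 ->
  velocity c 0 = (Z0, X0) -> forall t, I t -> c t = (z t, x t).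
Proof.
move=> Iitv I0 geo c0 v0.
have cst t : I t -> (velocity c t).1 - 2^-1 *: br (c t).2 (velocity c t).2 = Z0.
  move=> It; transitivity ((velocity c 0).1 - 2^-1 *: br (c 0).2
    (velocity c 0).2).
    apply: (mxderive_zero_interval (F := fun t => (velocity c t).1 - 2^-1 *: br
      (c t).2 (velocity c t).2) Iitv) => // u Iu.
    have [dc dv /(geodesic_equation adm) [e1 _]] := geo u Iu.
    apply: mxderive_eq (mxderiveB (mxderive_velocity1 dv) (mxderiveZl 2^-1
      (mxderive_bracket _ _ (mxderive_velocity2 dc) (mxderive_velocity2 dv))))
        _ _ => //.
    by rewrite e1 (bracketXX adm) add0r subrr.
  by rewrite c0 v0 /= bracket0l scaler0 subr0.
have vy t : I t -> (velocity c t).2 = y t.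
  move=> It; rewrite (@linear_ode_unique _ _ (J Z0) setT _ y)//.
  rewrite (@linear_ode_unique _ _ (J Z0) I _ (fun t => (velocity c t).2))//.
    by rewrite v0 /=; case: flow => -[_ _ ->].
  move=> u Iu; have [dc dv /(geodesic_equation adm) [_ e2]] := geo u Iu.
  by apply: (mxderive_eq (mxderive_velocity2 dv)) => //;
    rewrite e2 /left_translate /= cst.
have cx t : I t -> (c t).2 = x t.
  move=> It; apply/eqP; rewrite -subr_eq0; apply/eqP.
  transitivity ((c 0).2 - x 0); last by rewrite c0; case: flow => -[_ -> _];
    rewrite subrr.
  apply: (mxderive_zero_interval (F := fun t => (c t).2 - x t) Iitv) => // u Iu.
  have [dc _ _] := geo u Iu.
  by apply: mxderive_eq (mxderiveB (mxderive_velocity2 dc) (dx u)) _ _ => //;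
    rewrite vy// subrr.
move=> t It; rewrite [c t]surjective_pairing cx//; congr pair.
apply/eqP; rewrite -subr_eq0; apply/eqP.
transitivity ((c 0).1 - z 0); last by rewrite c0; case: flow => -[-> _ _];
  rewrite subrr.
apply: (mxderive_zero_interval (F := fun t => (c t).1 - z t) Iitv) => // u Iu.
have [dc _ _] := geo u Iu.
apply: mxderive_eq (mxderiveB (mxderive_velocity1 dc) (dz u)) _ _ => //.
by rewrite -(cst u Iu) cx// vy// subrK subrr.
Qed.

Variables (C : 'M[R]_(r + s)) (A : 'M[R]_n).
Hypotheses (CA : isotropy_derivation C A) (CZ0 : C *m Z0 = 0)
  (AX0 : A *m X0 = J Z0 *m X0).

Let a t : Gspace R r s n := ((z t, x t), (expmx C t, expmx A t)).

Lemma expmx_fix_center t : expmx C t *m Z0 = Z0.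
Proof.
rewrite -[RHS]mul1mx -(expmx0 C).
apply: (@mxderive_zero_interval _ setT _ _ (fun u => expmx C u *m Z0)) => // v
  _.
apply: (mxderive_eq (mxderiveMr Z0 (mxderive_expmxr C v))) => //.
by rewrite -mulmxA CZ0 mulmx0.
Qed.

(** Since A commutes with J_{Z0} and agrees with it on X0, both exponentials
    move X0 in the same way. *)
Lemma flow_velocity t : y t = expmx A t *m X0.
Proof.
rewrite (@linear_ode_unique _ _ (J Z0) setT _ y)//.
have -> : expmx A t *m X0 = expmx (J Z0) t *m (expmx A 0 *m X0).
  apply: (@linear_ode_unique _ _ (J Z0) setT _ (fun t => expmx A t *m X0)) =>
    // u _.
  apply: (mxderive_eq (mxderiveMr X0 (mxderive_expmxr A u))) => //.
  rewrite -mulmxA AX0 !mulmxA.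
  case: (expmx_Hgroup u CA) => _ /= uA _ _ /(_ Z0).
  by rewrite expmx_fix_center => E; rewrite -[in RHS]E mulmxKV.
by rewrite expmx0 mul1mx; case: flow => -[_ _ ->].
Qed.

(** The product law holds at u = 0, and both sides have the same derivative in
    u: this is where exp(tC) Z0 = Z0 and the invariance of the bracket under
    the isotropy group enter. *)
Lemma flow_one_parameter : one_parameter_subgroup J g a.
Proof.
have xD t u : x (t + u) = x t + expmx A t *m x u.
  apply/eqP; rewrite -subr_eq0; apply/eqP.
  transitivity (x (t + 0) - (x t + expmx A t *m x 0)); last first.
    by rewrite addr0; case: flow => -[_ -> _]; rewrite mulmx0 addr0 subrr.
  apply: (@mxderive_zero_interval _ setT _ _
    (fun u => x (t + u) - (x t + expmx A t *m x u))) => // v _.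
  apply: mxderive_eq (mxderiveB (mxderive_shift (dx (t + v)))
    (mxderiveD (mxderive_cst (x t) v) (mxderiveMl (expmx A t) (dx v)))) _ _ =>
    //.
  by rewrite add0r !flow_velocity expmxD mulmxA subrr.
have zD t u : z (t + u) = z t + expmx C t *m z u + 2^-1 *: br (x t)
  (expmx A t *m x u).
  apply/eqP; rewrite -subr_eq0; apply/eqP.
  pose f u := z (t + u) - (z t + expmx C t *m z u + 2^-1 *: br (x t)
    (expmx A t *m x u)).
  rewrite -/(f u); transitivity (f 0).
    apply: (@mxderive_zero_interval _ setT _ _ f) => // v _.
    have d1 := mxderive_shift (dz (t + v)).
    have d2 := mxderiveD (mxderive_cst (z t) v) (mxderiveMl (expmx C t) (dz v)).
    have d3 := mxderiveZl 2^-1 (mxderive_bracket J g (mxderive_cst (x t) v)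
      (mxderiveMl (expmx A t) (dx v))).
    apply: mxderive_eq (mxderiveB d1 (mxderiveD d2 d3)) _ _ => //.
    have /Hgroup_bracket /= := expmx_Hgroup t CA => E.
    rewrite add0r mulmxDr expmx_fix_center -scalemxAr -E !flow_velocity expmxD
      -mulmxA xD.
    rewrite bracketDl bracket0l add0r scalerDr -[in X in _ - X]addrA.
    by rewrite [X in _ - (_ + X)]addrC subrr.
  rewrite /f addr0; case: flow => -[-> -> _] _.
  by rewrite !mulmx0 bracket0r scaler0 !addr0 subrr.
split.
- by move=> t; exact: expmx_Hgroup.
- move=> t u; rewrite /a /Gmul /nmul /Hact /=.
  by rewrite -xD -zD !expmxD.
- split=> i; apply: mxderive_continuous => t.
  + by eexists; exact: dz.
  + by eexists; exact: dx.
- split=> i j; apply: mxderive_continuous => t; eexists; exact: mxderive_expmxl.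
Qed.

End GeodesicOrbits.

Lemma derive1n_id_derivable (R : realType) k (t : R) : derivable
  (derive1n k (@id R)) t 1.
Proof.
have d1 : derive1 (@id R) = cst 1.
  by apply/funext => u; rewrite derive1E derive_id.
have dk m : derive1n m.+2 (@id R) = cst 0.
  elim: m => [|m IH].
    rewrite /= d1; apply/funext => u; exact: derive1_cst.
  by rewrite derive1nS IH; apply/funext => u; exact: derive1_cst.
case: k => [|[|k]].
- exact: derivable_id.
- by rewrite /= d1; exact: derivable_cst.
- by rewrite dk; exact: derivable_cst.
Qed.

(** The condition on (C, A) is the algebraic criterion for homogeneous geodesics
    with k = 0. The flow is defined for all times, so a maximal geodesic is
    complete and no reparametrization is necessary. *)
Theorem isotropy_geodesic_orbit (R : realType) (r s n : nat)
    (J : {linear 'cV[R]_(r + s) -> 'M[R]_n}) (g : 'M[R]_n) :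
  admissible J g ->
  (forall (Z : 'cV[R]_(r + s)) (X : 'cV[R]_n), exists C A,
    [/\ isotropy_derivation J g C A, C *m Z = 0 & A *m X = J Z *m X]) ->
  geodesic_orbit J g.
Proof.
move=> adm iso I c [[oI iI] geo maxc] I0 c0.
pose Z0 := (velocity c 0).1; pose X0 := (velocity c 0).2.
have [C [A [CA CZ AX]]] := iso Z0 X0.
have [z [x [y fl]]] := geodesic_flow_exists adm Z0 X0.
have cE := geodesic_unique adm fl iI I0 geo c0 (surjective_pairing _).
have IT t : I t.
  apply: (maxc setT (fun t => (z t, x t))) => //.
  - by split; [exact: openT|].
  - exact: flow_geodesic fl.
  - by move=> u /cE.
exists (fun t => ((z t, x t), (expmx C t, expmx A t))), id; split.
- exact: (flow_one_parameter fl CA CZ AX).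
- split=> //; first exact: derive1n_id_derivable.
  by move=> t; rewrite derive1E derive_id.
- move=> t; split=> //; rewrite cE// /Gact /nmul /Hact /=.
  by rewrite !mulmx0 bracket0r scaler0 !addr0.
Qed.

(** * The module of split octonions *)

Section SplitOctonions.
Variable R : realType.

(** The matrix of y |-> zy for an imaginary split octonion z. Writing split
    octonions as pairs of quaternions, the product is
    (a,b)(c,d) = (ac + conj(d) b, da + b conj(c)); the coordinates z 0, z 1,
    z 2 are those of the imaginary quaternion a, and z 3, ..., z 6 those of b. *)
Definition octonion_table (z : nat -> R) : seq (seq R) :=
   [:: [:: 0; - z 0; - z 1; - z 2; z 3; z 4; z 5; z 6];
   [:: z 0; 0; - z 2; z 1; z 4; - z 3; - z 6; z 5];
   [:: z 1; z 2; 0; - z 0; z 5; z 6; - z 3; - z 4];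
   [:: z 2; - z 1; z 0; 0; z 6; - z 5; z 4; - z 3];
   [:: z 3; z 4; z 5; z 6; 0; - z 0; - z 1; - z 2];
   [:: z 4; - z 3; z 6; - z 5; z 0; 0; z 2; - z 1];
   [:: z 5; - z 6; - z 3; z 4; z 1; - z 2; 0; z 0];
   [:: z 6; z 5; - z 4; - z 3; z 2; z 1; - z 0; 0]].

Definition octonion_lmul (Z : 'cV[R]_(3 + 4)) : 'M[R]_8 :=
  \matrix_(i, j) nth 0 (nth [::] (octonion_table (fun k => Z (inord k) 0)) i) j.

Lemma octonion_linear : linear octonion_lmul.
Proof.
move=> a Z W; apply/matrixP => -[i hi] [j hj]; rewrite !mxE /=.
do 8 (destruct i as [|i]; [do 8 (destruct j as [|j];
  [by rewrite /= ?mxE; ring|]); by []|]).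
by [].
Qed.

HB.instance Definition _ :=
  GRing.isLinear.Build R _ _ _ octonion_lmul octonion_linear.

Lemma sprs34E (Z W : 'cV[R]_(3 + 4)) :
  let z k := Z (inord k) 0 in let w k := W (inord k) 0 in
  sprs Z W = z 0 * w 0 + z 1 * w 1 + z 2 * w 2
    - (z 3 * w 3 + z 4 * w 4 + z 5 * w 5 + z 6 * w 6).
Proof.
rewrite /= /sprs !big_ord_recl !big_ord0 !addr0 !addrA.
have E (i : 'I_(3 + 4)) : i = inord i by rewrite inord_val.
by do ![rewrite [lshift _ _]E /= | rewrite [rshift _ _]E /=].
Qed.

(** Split octonions are alternative, whence z(zy) = (zz)y, and the multiplication
    by an imaginary one is skew for the norm form, of signature (4,4). *)
Lemma octonion_admissible : admissible octonion_lmul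
  (diag_mx (\row_(i < 4 + 4) signature R i)).
Proof.
split.
- split=> [X Y|X H]; first by rewrite -!(@sprs_bform R 4 4) sprsC.
  by apply: (@sprs_nondeg R 4 4) => Y; rewrite sprs_bform.
- move=> Z; rewrite sprs34E; apply/matrixP => -[i hi] [j hj].
  rewrite !mxE !big_ord_recl big_ord0 !mxE /=.
  do 8 (destruct i as [|i]; [do 8 (destruct j as [|j]; [by rewrite /=; ring|]);
    by []|]).
  by [].
- move=> Z X Y; rewrite -!(@sprs_bform R 4 4).
  suff H : (octonion_lmul Z)^T *m diag_mx (\row_(i < 4 + 4) signature R i)
     = - (diag_mx (\row_(i < 4 + 4) signature R i) *m octonion_lmul Z).
    rewrite !sprs_bform /bform trmx_mul -(mulmxA X^T) H mulmxN mulNmx mxE.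
    by rewrite !mulmxA.
  rewrite mul_mx_diag mul_diag_mx; apply/matrixP => -[i hi] [j hj];
    rewrite !mxE /signature.
  do 8 (destruct i as [|i]; [do 8 (destruct j as [|j]; [by rewrite /=; ring|]);
    by []|]).
  by [].
Qed.

End SplitOctonions.

(** * Clifford relations and the normalizer of the space of generators *)

Lemma bform_delta (R : realType) n (g : 'M[R]_n) i j :
  bform g (delta_mx i 0) (delta_mx j 0) = g i j.
Proof. by rewrite /bform trmx_delta -rowE -colE !mxE. Qed.

Lemma bform_mull (R : realType) n (g A : 'M[R]_n) X Y :
  bform g (A *m X) Y = bform (A^T *m g) X Y.
Proof. by rewrite /bform trmx_mul !mulmxA. Qed.

Lemma bform_mulr (R : realType) n (g A : 'M[R]_n) X Y :
  bform g X (A *m Y) = bform (g *m A) X Y.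
Proof. by rewrite /bform !mulmxA. Qed.

Section CliffordRelations.
Variables (R : realType) (r s n : nat).
Variables (J : {linear 'cV[R]_(r + s) -> 'M[R]_n}) (g : 'M[R]_n).
Hypothesis adm : admissible J g.
Local Notation V := (range J).

Lemma J_anticomm Z W : J Z *m J W + J W *m J Z = (- (2 * sprs Z W))%:M.
Proof.
have := J_sqr adm (Z + W); rewrite linearD /= mulmxDl !mulmxDr !(J_sqr adm).
rewrite !sprs_bform !bformDl !bformDr -!sprs_bform [sprs W Z]sprsC.
set P := J Z *m J W; set Q := J W *m J Z => /matrixP E.
apply/matrixP => i j; have := E i j; rewrite !mxE.
by case: (i == j); rewrite ?mulr1n ?mulr0n; lra.
Qed.

Lemma so_formP A : so_form g A <-> A^T *m g = - (g *m A).
Proof.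
split=> [H|H X Y].
  apply/matrixP => i j; have := H (delta_mx i 0) (delta_mx j 0).
  by rewrite bform_mull bform_mulr !bform_delta => ->; rewrite [RHS]mxE.
by rewrite bform_mull H bform_mulr /bform mulmxN mulNmx mxE.
Qed.

Lemma so_formD A B : so_form g A -> so_form g B -> so_form g (A + B).
Proof. by move=> a b X Y; rewrite !mulmxDl bformDl bformDr a b opprD. Qed.

Lemma so_formZ a A : so_form g A -> so_form g (a *: A).
Proof. by move=> h X Y; rewrite -!scalemxAl bformZl bformZr h mulrN. Qed.

Lemma so_formB A B : so_form g A -> so_form g B -> so_form g (A - B).
Proof. by move=> a b; rewrite -scaleN1r; exact/so_formD/so_formZ. Qed.

Lemma so_form_sum (I : finType) (F : I -> 'M[R]_n) :
  (forall i, so_form g (F i)) -> so_form g (\sum_i F i).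
Proof.
move=> H; elim/big_ind : _ => //; last by move=> *; exact: so_formD.
by move=> X Y; rewrite !mul0mx bform0l bform0r oppr0.
Qed.

Lemma so_form_lie A B : so_form g A -> so_form g B -> so_form g (lie_mx A B).
Proof.
move=> a b X Y; rewrite /lie_mx !mulmxBl bformBl bformBr -!mulmxA !(a, b).
by rewrite !opprK opprB.
Qed.

Lemma so_form_J Z : so_form g (J Z).
Proof. exact: J_skew adm Z. Qed.

(** [V, V] acts on V as the infinitesimal rotations of R^{r,s}. *)
Lemma lie_lieJ Z W U : lie_mx (lie_mx (J Z) (J W)) (J U) =
  J (4 *: (sprs Z U *: W - sprs W U *: Z)).
Proof.
have -> : J (4 *: (sprs Z U *: W - sprs W U *: Z))
    = 4 *: (sprs Z U *: J W - sprs W U *: J Z).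
  by rewrite linearZ linearB !linearZ.
have h1 := congr1 (mulmx (J Z)) (J_anticomm W U).
have h2 := congr1 (fun M => M *m J W) (J_anticomm Z U).
have h3 := congr1 (mulmx (J W)) (J_anticomm Z U).
have h4 := congr1 (fun M => M *m J Z) (J_anticomm W U).
move: h1 h2 h3 h4; rewrite !mulmxDr !mulmxDl !mul_mx_scalar !mul_scalar_mx.
rewrite /lie_mx !mulmxBl !mulmxBr !mulmxA.
set P1 := J Z *m J W *m J U; set P2 := J Z *m J U *m J W.
set P3 := J U *m J Z *m J W; set P4 := J W *m J Z *m J U.
set P5 := J W *m J U *m J Z; set P6 := J U *m J W *m J Z.
move=> /matrixP h1 /matrixP h2 /matrixP h3 /matrixP h4; apply/matrixP => i j.
move: (h1 i j) (h2 i j) (h3 i j) (h4 i j); rewrite !mxE; lra.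
Qed.

Lemma commutator_sub_normalizer : commutator_span V `<=` so_normalizer g V.
Proof.
move=> _ [k [a [F [HF ->]]]]; split.
  apply: so_form_sum => i; apply: so_formZ.
  have [_ [Z _ <-] [_ [W _ <-] <-]] := HF i.
  by apply: so_form_lie; exact: so_form_J.
move=> _ [U _ <-].
have /choice[f fE] : forall i, exists T, J T = lie_mx (F i) (J U).
  move=> i; have [_ [Z _ <-] [_ [W _ <-] <-]] := HF i.
  by eexists; rewrite lie_lieJ.
exists (\sum_i a i *: f i) => //.
rewrite linear_sum /lie_mx mulmx_suml mulmx_sumr -sumrB; apply: eq_bigr => i _.
by rewrite linearZ /= fE /lie_mx scalerBr scalemxAl scalemxAr.
Qed.

Hypothesis n0 : (0 < n)%N.

Lemma J_inj Z : J Z = 0 -> Z = 0.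
Proof.
move=> Z0; apply: sprs_nondeg => W.
have := J_anticomm Z W; rewrite Z0 mul0mx mulmx0 addr0 => /matrixP.
move=> /(_ (Ordinal n0) (Ordinal n0)); rewrite !mxE eqxx mulr1n; lra.
Qed.

(** A skew operator that normalizes V induces a linear map C of the centre, as J
    is injective. Bracketing the Clifford relation with B shows that C is
    skew. *)
Lemma normalizer_isotropy B :
  so_normalizer g V B -> exists C, isotropy_derivation J g C B.
Proof.
move=> [Bso BV].
have /choice[f fE] : forall j, exists W, J W = lie_mx B (J (delta_mx j 0)).
  by move=> j; have [|W _ WE] := BV (J (delta_mx j 0));
    [by exists (delta_mx j 0)|exists W].
pose C : 'M[R]_(r + s) := \matrix_(i, j) f j i 0.
have CE W : lie_mx B (J W) = J (C *m W).
  have -> : C *m W = \sum_j W j 0 *: f j.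
    by apply/colP => i; rewrite !mxE summxE; apply: eq_bigr => j _;
      rewrite !mxE mulrC.
  rewrite [in LHS](matrix_sum_delta W) !linear_sum /lie_mx mulmx_suml
    mulmx_sumr -sumrB.
  apply: eq_bigr => j _; rewrite big_ord1 !linearZ /= fE /lie_mx scalerBr.
  by rewrite -scalemxAl.
exists C; split=> // Z W.
have h1 := J_anticomm (C *m Z) W; have h2 := J_anticomm Z (C *m W).
have h3 := congr1 (mulmx B) (J_anticomm Z W).
have h4 := congr1 (mulmx^~ B) (J_anticomm Z W).
move: h1 h2 h3 h4; rewrite -!CE /lie_mx mul_mx_scalar mul_scalar_mx.
rewrite !(mulmxBl, mulmxBr) !(mulmxDl, mulmxDr) !mulmxA.
set P1 := B *m J Z *m J W; set P2 := J Z *m B *m J W; set P3 := J W *m B *m J Z.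
set P4 := J W *m J Z *m B; set P5 := J Z *m J W *m B; set P6 := B *m J W *m J Z.
move=> /matrixP h1 /matrixP h2 /matrixP h3 /matrixP h4.
pose o := Ordinal n0.
move: (h1 o o) (h2 o o) (h3 o o) (h4 o o); rewrite !mxE eqxx !mulr1n; lra.
Qed.

End CliffordRelations.

(** * Monomials in the generators and the orthonormal frame *)

(** Whether the generator number [k] anticommutes with the [a]-th element of the
    list 1, J_1, ..., J_7; the generators are numbered from 0, hence the
    successor. *)
Definition anticommutes (k a : nat) : bool := (a != 0%N) && (a != k.+1).

(** Distinct unordered pairs of elements of 1, J_1, ..., J_7 are told apart by
    the generators with which their products anticommute. *)
Lemma anticommutes_separates4 a b i j : (a < b < 8)%N -> (i < j < 8)%N ->
  (a, b) != (i, j) ->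
  exists2 k, (k < 7)%N & odd (count (anticommutes k) [:: a; b; i; j]).
Proof.
have /allP H : all (fun a => all (fun b => all (fun i => all (fun j =>
    (a < b)%N ==> (i < j)%N ==> ((a, b) != (i, j)) ==>
    has (fun k => odd (count (anticommutes k) [:: a; b; i; j])) (iota 0 7))
  (iota 0 8)) (iota 0 8)) (iota 0 8)) (iota 0 8) by vm_compute.
move=> /andP[ab b8] /andP[ij j8] ne.
have mem x : (x < 8)%N -> x \in iota 0 8 by rewrite mem_iota.
have /allP/(_ b (mem _ b8))/allP/(_ i (mem _ (ltn_trans ij j8))) :=
  H a (mem _ (ltn_trans ab b8)).
move=> /allP/(_ j (mem _ j8)); rewrite ab ij ne => /hasP[k].
by rewrite mem_iota => k7 ko; exists k.
Qed.

(** If m, l, k are distinct, every fourth generator anticommutes with the product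
    of the three; otherwise this product is, up to sign, a single generator,
    with which every other one anticommutes. *)
Lemma anticommutes_separates3 m l k : (m < 7)%N -> (l < 7)%N -> (k < 7)%N -> l
  != k ->
  exists2 p, (p < 7)%N & odd (count (anticommutes p) [:: m.+1; l.+1; k.+1]).
Proof.
have /allP H : all (fun m => all (fun l => all (fun k => (l != k) ==>
    has (fun p => odd (count (anticommutes p) [:: m.+1; l.+1; k.+1]))
      (iota 0 7))
  (iota 0 7)) (iota 0 7)) (iota 0 7) by vm_compute.
have mem x : (x < 7)%N -> x \in iota 0 7 by rewrite mem_iota.
move=> m7 l7 k7 ne; have /allP/(_ l (mem _ l7))/allP/(_ k (mem _ k7)) := H m
  (mem _ m7).
by rewrite ne => /hasP[p]; rewrite mem_iota => p7 po; exists p.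
Qed.

Section Monomials.
Variables (R : realType) (n : nat).
Variables (J : {linear 'cV[R]_(3 + 4) -> 'M[R]_n}) (g : 'M[R]_n).
Hypothesis adm : admissible J g.

Definition cgen (i : 'I_(3 + 4)) : 'M[R]_n := J (delta_mx i 0).

(** The list 1, J_1, ..., J_7, indexed by eight integers. With 1 as an additional
    generator, the J_k and the products J_i J_j become products over pairs of
    indices of one and the same kind. *)
Definition cgen1 (a : 'I_8) : 'M[R]_n := oapp cgen 1%:M (unlift ord0 a).

Definition monomial (w : seq 'I_8) : 'M[R]_n :=
  foldr (fun a M => cgen1 a *m M) 1%:M w.

Lemma cgen1_0 : cgen1 ord0 = 1%:M. Proof. by rewrite /cgen1 unlift_none. Qed.

Lemma cgen1_lift i : cgen1 (lift ord0 i) = cgen i.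
Proof. by rewrite /cgen1 liftK. Qed.

Lemma cgen_sqr i : cgen i *m cgen i = (- signature R i)%:M.
Proof. by rewrite /cgen (J_sqr adm) sprs_deltar mxE !eqxx mulr1. Qed.

Lemma cgen_anticomm i j : i != j -> cgen i *m cgen j = - (cgen j *m cgen i).
Proof.
move=> ij; apply/eqP; rewrite -addr_eq0 /cgen (J_anticomm adm) sprs_deltar mxE.
by rewrite [j == i]eq_sym (negPf ij) !mulr0 oppr0 raddf0.
Qed.

Lemma cgen_cgen1 (k : 'I_(3 + 4)) (a : 'I_8) :
  cgen k *m cgen1 a = (-1) ^+ anticommutes k a *: (cgen1 a *m cgen k).
Proof.
case: (unliftP ord0 a) => [i|] ->; last first.
  by rewrite cgen1_0 mulmx1 mul1mx scale1r.
rewrite cgen1_lift /anticommutes /= /bump /= add1n eqSS.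
have [ik|ik] := eqVneq (i : nat) k; first by rewrite (val_inj ik) scale1r.
by rewrite expr1 scaleN1r cgen_anticomm// eq_sym.
Qed.

Lemma cgen_monomial (k : 'I_(3 + 4)) w :
  cgen k *m monomial w
  = (-1) ^+ count (anticommutes k) (map val w) *: (monomial w *m cgen k).
Proof.
elim: w => [|a w IH] /=; first by rewrite mulmx1 mul1mx scale1r.
rewrite mulmxA cgen_cgen1 -scalemxAl -mulmxA IH -scalemxAr scalerA -exprD.
by rewrite mulmxA.
Qed.

(** If c anticommutes with M, then tr(c M c) equals both c^2 tr(M) and
    - c^2 tr(M). *)
Lemma monomial_trace0 (k : 'I_(3 + 4)) w :
  odd (count (anticommutes k) (map val w)) -> \tr (monomial w) = 0.
Proof.
move=> ko; have E := cgen_monomial k w.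
have T : \tr (cgen k *m monomial w *m cgen k) = - signature R k * \tr
  (monomial w).
  by rewrite mxtrace_mulC mulmxA cgen_sqr mul_scalar_mx mxtraceZ.
move: T; rewrite E -signr_odd ko expr1 scaleN1r mulNmx -mulmxA cgen_sqr.
rewrite mul_mx_scalar linearN /= mxtraceZ => T.
have /(congr1 ( *%R (signature R k))) : signature R k * \tr (monomial w) = 0 by
  lra.
by rewrite mulrA signature_sqr mul1r mulr0.
Qed.

Lemma monomial2_so (a b : 'I_8) : (a < b)%N -> so_form g (cgen1 a *m cgen1 b).
Proof.
case: (unliftP ord0 b) => [j|] -> //; case: (unliftP ord0 a) => [i|] ->;
  last first.
  by move=> _; rewrite cgen1_0 cgen1_lift mul1mx; exact: so_form_J.
rewrite !cgen1_lift => ab X Y.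
rewrite -!mulmxA /cgen !(J_skew adm) opprK mulmxA -/(cgen i) -/(cgen j).
rewrite [cgen i *m (_ *m _)]mulmxA (@cgen_anticomm i j) ?mulNmx ?bformNr
  ?opprK//.
by rewrite neq_ltn; move: ab; rewrite /= /bump /= !add1n ltnS => ->.
Qed.

Lemma monomial2_sqr (a b : 'I_8) : (a < b)%N -> exists2 c : R, c != 0 &
  cgen1 a *m cgen1 b *m (cgen1 a *m cgen1 b) = c%:M.
Proof.
have sgm0 (i : 'I_(3 + 4)) : signature R i != 0 :> R.
  by rewrite /signature; case: ifP; rewrite ?oppr_eq0 oner_eq0.
case: (unliftP ord0 b) => [j|] -> //; case: (unliftP ord0 a) => [i|] ->;
  last first.
  move=> _; exists (- @signature R 3 4 j); first by rewrite oppr_eq0.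
  by rewrite cgen1_0 cgen1_lift !mul1mx cgen_sqr.
rewrite !cgen1_lift => ab; exists (- (@signature R 3 4 i * @signature R 3 4 j)).
  by rewrite oppr_eq0 mulf_neq0.
rewrite mulmxA -(mulmxA (cgen i)) (@cgen_anticomm j i); last first.
  by rewrite neq_ltn orbC; move: ab; rewrite /= /bump /= !add1n ltnS => ->.
rewrite mulmxN mulNmx mulmxA cgen_sqr -mulmxA cgen_sqr -scalar_mxM.
by rewrite -raddfN /= mulrNN.
Qed.

(** For a < b, <c_a X, c_b X> is, up to sign, <X, c_a c_b X>, which is zero
    because c_a c_b is skew. *)
Lemma cgen1_frame X (a b : 'I_8) : bform g X X = 1 ->
  bform g (cgen1 a *m X) (cgen1 b *m X) = (a == b)%:R * @signature R 4 4 a.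
Proof.
move=> X1.
have skew0 A : so_form g A -> bform g X (A *m X) = 0.
  by move=> /(_ X X); rewrite [bform g (A *m X) X](bformC adm); lra.
wlog ab : a b / (a <= b)%N => [H|].
  have /orP[/H//|/H E] := leq_total a b.
  by rewrite (bformC adm) E eq_sym; case: eqP => [->|]; rewrite ?mul0r.
move: ab; rewrite leq_eqVlt => /orP[/eqP/val_inj <-|ab].
  rewrite eqxx mul1r; case: (unliftP ord0 a) => [i|] ->.
    rewrite cgen1_lift (J_skew adm) mulmxA cgen_sqr mul_scalar_mx bformZr X1.
    by rewrite mulr1 opprK.
  by rewrite cgen1_0 mul1mx X1.
rewrite (negPf (_ : a != b)) ?mul0r; last by rewrite neq_ltn ab.
have M := skew0 _ (monomial2_so ab).
case: (unliftP ord0 a) ab M => [i|] -> ab; last by rewrite cgen1_0 !mul1mx.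
by rewrite cgen1_lift (J_skew adm) mulmxA => ->; rewrite oppr0.
Qed.

(** The matrix with columns X, J_1 X, ..., J_7 X. The first four have squared
    norm <X,X>, the last four its opposite, which is why the source is
    R^{4+4}. *)
Definition frame (X : 'cV[R]_n) : 'M[R]_(n, 4 + 4) := \matrix_(i, a)
  (cgen1 a *m X) i 0.

Lemma frame_isometry X Z W : bform g X X = 1 ->
  bform g (frame X *m Z) (frame X *m W) = @sprs R 4 4 Z W.
Proof.
move=> X1.
have E U : frame X *m U = \sum_a U a 0 *: (cgen1 a *m X).
  by apply/colP => i; rewrite mxE summxE; apply: eq_bigr => a _;
    rewrite !mxE mulrC.
have suml (F : 'I_8 -> 'cV[R]_n) Y : bform g (\sum_a F a) Y = \sum_a bform g
  (F a) Y.
  by elim/big_rec2: _ => [|a u v _ <-]; rewrite ?bform0l ?bformDl.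
have sumr (F : 'I_8 -> 'cV[R]_n) Y : bform g Y (\sum_a F a) = \sum_a bform g Y
  (F a).
  by elim/big_rec2: _ => [|a u v _ <-]; rewrite ?bform0r ?bformDr.
rewrite !E suml sprsE; apply: eq_bigr => a _.
rewrite sumr (bigD1 a) //= big1 ?addr0 => [|b ba].
  by rewrite bformZl bformZr (cgen1_frame _ _ X1) eqxx mul1r mulrA mulrC mulrA.
by rewrite bformZl bformZr (cgen1_frame _ _ X1) [a == b]eq_sym (negPf ba) mul0r
  !mulr0.
Qed.

Lemma frame_free X : bform g X X = 1 -> row_free (frame X)^T.
Proof.
move=> X1; apply: inj_row_free => v v0; apply: trmx_inj; rewrite trmx0.
apply: (@sprs_nondeg R 4 4) => W; rewrite -(frame_isometry _ _ X1).
by rewrite -[frame X *m v^T]trmxK trmx_mul !trmxK v0 trmx0 bform0l.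
Qed.

Lemma frame_dim X : bform g X X = 1 -> (8 <= n)%N.
Proof.
move=> /frame_free/eqP r8.
by have := rank_leq_col (frame X)^T; rewrite r8.
Qed.

Hypothesis n0 : (0 < n)%N.

(** A vector of negative square is turned into one of positive square by a
    generator of square +1, which reverses the form. *)
Lemma unit_vector_exists : exists X, bform g X X = 1.
Proof.
have [X X0] : exists X, bform g X X != 0.
  apply/not_existsP => H; have H0 X : bform g X X = 0.
    by apply/eqP; have /negP := H X; rewrite negbK.
  pose d : 'cV[R]_n := delta_mx (Ordinal n0) 0.
  have : d = 0.
    apply: (bform_nondeg adm) => Y; have := H0 (d + Y).
    by rewrite bformDl !bformDr !H0 [bform g Y d](bformC adm); lra.
  by move=> /colP/(_ (Ordinal n0)); rewrite !mxE !eqxx => /eqP;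
    rewrite oner_eq0.
have [Y Y0] : exists Y, 0 < bform g Y Y.
  have [Xp|Xn|/eqP] := ltgtP (bform g X X) 0; last by rewrite (negPf X0).
    exists (cgen (rshift 3 ord0) *m X).
    rewrite (J_skew adm) mulmxA cgen_sqr mul_scalar_mx bformZr.
    by rewrite /signature /= opprK mul1r oppr_gt0.
  by exists X.
exists ((Num.sqrt (bform g Y Y))^-1 *: Y).
rewrite bformZl bformZr mulrA -invfM -expr2 sqr_sqrtr ?ltW//.
by rewrite mulVf// gt_eqF.
Qed.

End Monomials.

(** The frame gives at least 8, and the split octonions give at most 8. *)
Lemma minimal_admissible_dim (R : realType) (n : nat)
    (J : {linear 'cV[R]_(3 + 4) -> 'M[R]_n}) (g : 'M[R]_n) :
  minimal_admissible J g -> n = 8.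
Proof.
move=> [n0 adm min]; apply/eqP; rewrite eqn_leq.
rewrite (min _ _ _ _ (octonion_admissible R))//=.
by have [X X1] := unit_vector_exists adm n0; exact: (frame_dim adm X1).
Qed.

(** * The eight-dimensional module *)

Section Dimension8.
Variables (R : realType).
Variables (J : {linear 'cV[R]_(3 + 4) -> 'M[R]_8}) (g : 'M[R]_8).
Hypothesis adm : admissible J g.
Local Notation V := (range J).

Definition pairs := {p : 'I_8 * 'I_8 | (p.1 < p.2)%N}.

(** The 28 operators J_k and J_i J_j with i < j, as products over pairs of
    indices in the list 1, J_1, ..., J_7. *)
Definition bivector (k : 'I_#|{: pairs}|) : 'M[R]_8 :=
  cgen1 J (val (enum_val k)).1 *m cgen1 J (val (enum_val k)).2.

Lemma bivector_so k : so_form g (bivector k).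
Proof. exact: (monomial2_so adm (valP (enum_val k))). Qed.

Lemma bivector_trace k l : k != l -> \tr (bivector k *m bivector l) = 0.
Proof.
move=> kl; rewrite /bivector.
have : enum_val k != enum_val l by rewrite (inj_eq enum_val_inj).
case: (enum_val k) => -[a b] /= ab; case: (enum_val l) => -[i j] /= ij.
rewrite -val_eqE /= => ne.
have [||p p7 po] := @anticommutes_separates4 a b i j _ _ ne;
  rewrite ?ab ?ij ?ltn_ord//.
have -> : cgen1 J a *m cgen1 J b *m (cgen1 J i *m cgen1 J j) = monomial J
  [:: a; b; i; j].
  by rewrite /= mulmx1 -!mulmxA.
exact: (@monomial_trace0 _ _ _ _ adm (Ordinal p7)).
Qed.

(** A skew operator A is determined by the antisymmetric matrix gA, hence by its
    entries above the diagonal. These are indexed by the same pairs as the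
    operators [bivector]. *)
Definition upper_entries (A : 'M[R]_8) : 'rV[R]_#|{: pairs}| :=
  \row_k (g *m A) (val (enum_val k)).1 (val (enum_val k)).2.

Lemma upper_sum m (v : 'rV[R]_m) (F : 'I_m -> 'M[R]_8) :
  upper_entries (\sum_k v 0 k *: F k) = v *m \matrix_k upper_entries (F k).
Proof.
apply/rowP => l; rewrite mxE mulmx_sumr summxE [RHS]mxE.
by apply: eq_bigr => k _; rewrite -scalemxAr mxE !mxE.
Qed.

Lemma upper_inj A : so_form g A -> upper_entries A = 0 -> A = 0.
Proof.
move=> Aso A0.
have gC i j : g i j = g j i by rewrite -!bform_delta (bformC adm).
have gA0 : g *m A = 0.
  have sk : (g *m A)^T = - (g *m A).
    rewrite trmx_mul -(so_formP g A).1//; congr (_ *m _).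
    by apply/matrixP => i j; rewrite mxE gC.
  have up (i j : 'I_8) : (i < j)%N -> (g *m A) i j = 0.
    move=> ij; pose p : pairs := exist (fun p : 'I_8 * 'I_8 => (p.1 < p.2)%N)
      (i, j) ij.
    transitivity (upper_entries A 0 (enum_rank p));
      first by rewrite [RHS]mxE enum_rankK.
    by rewrite A0 mxE.
  apply/matrixP => i j; rewrite [RHS]mxE;
    have [ij|ij|/val_inj <-] := ltngtP i j.
  - exact: up.
  - by move/matrixP/(_ j i): sk; rewrite [LHS]mxE => ->; rewrite mxE up ?oppr0.
  - by move/matrixP/(_ i i): sk; rewrite [LHS]mxE [RHS]mxE; lra.
apply/matrixP => i j; rewrite [RHS]mxE.
have /colP/(_ i) : A *m (delta_mx j 0 : 'cV_8) = 0.
  apply: (bform_nondeg adm) => Y.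
  by rewrite Aso bform_mulr gA0 /bform mulmx0 mul0mx mxE oppr0.
by rewrite -colE !mxE.
Qed.

Lemma bivector_coef (v : 'rV[R]_#|{: pairs}|) k :
  \tr ((\sum_l v 0 l *: bivector l) *m bivector k)
  = v 0 k * \tr (bivector k *m bivector k).
Proof.
rewrite mulmx_suml raddf_sum (bigD1 k)//= big1 ?addr0 => [|l lk].
  by rewrite -scalemxAl mxtraceZ.
by rewrite -scalemxAl mxtraceZ bivector_trace ?mulr0.
Qed.

Lemma bivector_trace_neq0 k : \tr (bivector k *m bivector k) != 0.
Proof.
have [c c0 E] := monomial2_sqr adm (valP (enum_val k)).
by rewrite /bivector E mxtrace_scalar -mulr_natr mulf_neq0// pnatr_eq0.
Qed.

(** The entries above the diagonal of the 28 operators form a square matrix,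
    both sides being indexed by the same pairs. It is injective by
    trace-orthogonality, hence invertible. *)
Lemma so_bivector_span A : so_form g A ->
  exists v : 'rV_#|{: pairs}|, A = \sum_k v 0 k *: bivector k.
Proof.
move=> Aso; pose K := \matrix_k upper_entries (bivector k).
have so_sum (v : 'rV_#|{: pairs}|) : so_form g (\sum_k v 0 k *: bivector k).
  by apply: so_form_sum => k; apply: so_formZ; exact: bivector_so.
have Kfree : row_free K.
  apply: inj_row_free => v; rewrite -upper_sum => /(upper_inj (so_sum v)) v0.
  apply/rowP => k; rewrite mxE; apply/eqP.
  have := bivector_coef v k; rewrite v0 mul0mx mxtrace0 => /esym/eqP.
  by rewrite mulf_eq0 (negPf (bivector_trace_neq0 k)) orbF.
have Kunit : K \in unitmx by rewrite -row_free_unit.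
exists (upper_entries A *m invmx K); apply/eqP; rewrite -subr_eq0; apply/eqP.
apply: upper_inj; first exact: so_formB.
rewrite /upper_entries mulmxBr.
have <- : upper_entries A - upper_entries
  (\sum_k (upper_entries A *m invmx K) 0 k *: bivector k) = 0.
  by rewrite upper_sum mulmxKV// subrr.
by apply/rowP => k; rewrite !mxE.
Qed.

(** In the expansion of A over the 28 operators, the coefficient of J_k is a
    multiple of tr(A J_k), and J_i J_j is half the commutator of J_i and
    J_j. *)
Lemma trace0_commutator A :
  so_form g A -> (forall k, \tr (A *m cgen J k) = 0) -> commutator_span V A.
Proof.
move=> /so_bivector_span[v ->] H.
pose z (a : 'I_8) : 'cV[R]_(3 + 4) := oapp (fun i => delta_mx i 0) 0
  (unlift ord0 a).
exists #|{: pairs}|, (fun k => 2^-1 * v 0 k),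
  (fun k => lie_mx (J (z (val (enum_val k)).1)) (J (z (val (enum_val k)).2)));
    split.
  by move=> k; eexists; [by eexists|eexists; [by eexists|]].
apply: eq_bigr => k _; have := bivector_coef v k; have := bivector_trace_neq0 k.
rewrite /bivector; have := valP (enum_val k) => /=.
case: (val (enum_val k)) => a b /=.
case: (unliftP ord0 b) => [j|] -> //; case: (unliftP ord0 a) => [i|] ->;
  last first.
  rewrite !cgen1_0 !cgen1_lift !mul1mx => _ t0; rewrite H => /esym/eqP.
  rewrite mulf_eq0 (negPf t0) orbF => /eqP ->.
  by rewrite mulr0 !scale0r.
move=> ij _ _; rewrite !cgen1_lift /z !liftK /= -!/(cgen J _) /lie_mx.
rewrite (@cgen_anticomm _ _ _ _ adm j i); last first.
  by rewrite neq_ltn orbC; move: ij; rewrite /= /bump /= !add1n ltnS => ->.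
rewrite opprK -mulr2n -scalerMnr scalerMnl; congr (_ *: _).
by rewrite -mulr_natr; field.
Qed.

(** For l != k, the trace of [A, J_l] J_l J_k is 2 J_l^2 tr(A J_k). If A
    normalizes V, then [A, J_l] lies in V, and this trace vanishes. *)
Lemma normalizer_trace0 A k : so_normalizer g V A -> \tr (A *m cgen J k) = 0.
Proof.
move=> [Aso AV].
pose l : 'I_(3 + 4) := if k == ord0 then ord_max else ord0.
have lk : l != k by rewrite /l; have [->|] := eqVneq k ord0; rewrite // eq_sym.
have [|T _ TE] := AV (cgen J l); first by exists (delta_mx l 0).
have T0 : \tr (J T *m (cgen J l *m cgen J k)) = 0.
  rewrite [T]matrix_sum_delta linear_sum mulmx_suml raddf_sum big1// => m _.
  rewrite big_ord1 linearZ /= -scalemxAl mxtraceZ -/(cgen J m).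
  have [p p7 po] := anticommutes_separates3 (ltn_ord m) (ltn_ord l) (ltn_ord k)
    lk.
  have -> : cgen J m *m (cgen J l *m cgen J k)
     = monomial J [:: lift ord0 m; lift ord0 l; lift ord0 k].
    by rewrite /= !cgen1_lift mulmx1.
  by rewrite (@monomial_trace0 _ _ _ _ adm (Ordinal p7)) ?mulr0.
move: T0; rewrite TE /lie_mx mulmxBl raddfB /=.
rewrite -[A *m _ *m _]mulmxA (mulmxA (cgen J l)) (cgen_sqr adm) mul_scalar_mx.
rewrite -[cgen J l *m A *m _]mulmxA [\tr (cgen J l *m _)]mxtrace_mulC.
rewrite -!mulmxA (cgen_anticomm adm (i := k)) ?[k == l]eq_sym// mulmxN.
rewrite mulmxA (cgen_sqr adm) mul_scalar_mx -scalemxAr mulmxN -scalemxAr raddfN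
  /= mxtraceZ.
move=> E; have /(congr1 ( *%R (signature R l))) : signature R l * \tr
  (A *m cgen J k) = 0 by lra.
by rewrite mulrA signature_sqr mul1r mulr0.
Qed.

Lemma normalizer_commutator : so_normalizer g V = commutator_span V.
Proof.
apply/seteqP; split=> A; last exact: (commutator_sub_normalizer adm).
move=> AN; apply: trace0_commutator => [|k]; first by case: AN.
exact: normalizer_trace0.
Qed.

(** The symmetric operator U |-> <X,U> Y + <Y,U> X. *)
Definition symprod (X Y : 'cV[R]_8) : 'M[R]_8 :=
  Y *m X^T *m g + X *m Y^T *m g.

(** The first two terms are twice the skew part of the anticommutator of J_Z
    with the rank one operator U |-> <X,U> Y; the last term removes its
    component in V, as dictated by [compensator_trace0]. *)
Definition compensator (Z : 'cV[R]_(3 + 4)) (X Y : 'cV[R]_8) : 'M[R]_8 :=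
  J Z *m symprod X Y + symprod X Y *m J Z - (2^-1 * bform g X Y) *: J Z.

Let rank1_mul (X Y U : 'cV[R]_8) : Y *m X^T *m g *m U = bform g X U *: Y.
Proof.
rewrite -!mulmxA (mulmxA X^T); apply/colP => i; rewrite !mxE big_ord1 mulrC.
by rewrite /bform.
Qed.

Lemma compensatorE Z X Y U : compensator Z X Y *m U =
  bform g X U *: (J Z *m Y) + bform g Y U *: (J Z *m X)
  + (bform g X (J Z *m U) *: Y + bform g Y (J Z *m U) *: X)
  - (2^-1 * bform g X Y) *: (J Z *m U).
Proof.
rewrite /compensator; have KE W : symprod X Y *m W = bform g X W *: Y + bform g
  Y W *: X.
  by rewrite mulmxDl !rank1_mul.
rewrite mulmxBl mulmxDl -scalemxAl -!mulmxA !KE mulmxDr.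
by rewrite -!scalemxAr.
Qed.

(** An anticommutator with J_Z commutes with J_Z, whose square is a scalar. *)
Lemma compensator_lie Z X Y : lie_mx (compensator Z X Y) (J Z) = 0.
Proof.
rewrite /compensator /lie_mx; move: (symprod X Y) => K.
rewrite mulmxBl mulmxBr mulmxDl mulmxDr -scalemxAl -scalemxAr !mulmxA.
rewrite -(mulmxA K) (J_sqr adm) mul_mx_scalar mul_scalar_mx.
by rewrite [X in X - _ - _]addrC subrr.
Qed.

Lemma compensator_so Z X Y : so_form g (compensator Z X Y).
Proof.
have sym U W : bform g (symprod X Y *m U) W = bform g U (symprod X Y *m W).
  rewrite !mulmxDl !rank1_mul !(bformDl, bformDr, bformZl, bformZr).
  by rewrite ![bform g U _](bformC adm); ring.
apply: so_formB; last by apply: so_formZ; exact: so_form_J.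
move=> U W; move: (symprod X Y) sym => K sym.
rewrite !mulmxDl bformDl bformDr -!mulmxA (J_skew adm) !sym (J_skew adm).
by rewrite addrC -opprD.
Qed.

Lemma trace_rank1 (X Y : 'cV[R]_8) (M : 'M[R]_8) :
  \tr (Y *m X^T *m g *m M) = bform g X (M *m Y).
Proof.
by rewrite -!mulmxA mxtrace_mulC /mxtrace big_ord1 /bform !mulmxA.
Qed.

(** The Clifford relation reduces the trace to tr(K) <Z, e_k> and to
    tr(J_Z J_k), with tr(K) = 2 <X,Y> and, in dimension 8,
    tr(J_Z J_k) = - 8 <Z, e_k>; the coefficient 1/2 balances the two. *)
Lemma compensator_trace0 Z X Y k : \tr (compensator Z X Y *m cgen J k) = 0.
Proof.
rewrite /compensator; have KE M : \tr (symprod X Y *m M) = bform g X (M *m Y) +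
  bform g Y (M *m X).
  by rewrite mulmxDl raddfD /= !trace_rank1.
move: (symprod X Y) KE => K KE.
rewrite mulmxBl mulmxDl raddfB raddfD /= -scalemxAl mxtraceZ.
rewrite -[J Z *m _ *m _]mulmxA [\tr (J Z *m _)]mxtrace_mulC -!mulmxA.
rewrite -mxtraceD -mulmxDr addrC [cgen J k *m _ + _]addrC /cgen
  (J_anticomm adm).
rewrite KE !mul_scalar_mx !bformZr (bformC adm Y X).
have := congr1 mxtrace (J_anticomm adm Z (delta_mx k 0)).
rewrite mxtraceD [\tr (J (delta_mx k 0) *m _)]mxtrace_mulC mxtrace_scalar.
by rewrite -mulr_natr; nra.
Qed.

Lemma compensator_fix Z X Y : compensator Z X Y *m Y =
  (2^-1 * bform g X Y) *: (J Z *m Y) + bform g Y Y *: (J Z *m X)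
  + bform g X (J Z *m Y) *: Y.
Proof.
have Y0 : bform g Y (J Z *m Y) = 0.
  by have := so_form_J adm Z Y Y; rewrite (bformC adm); lra.
rewrite compensatorE Y0 scale0r addr0.
set U := J Z *m Y; set W := J Z *m X.
by apply/colP => i; rewrite !mxE; field.
Qed.

(** If some X is orthogonal to U but not to Y, rescaling it to <X,Y> = 2 is
    enough. Otherwise U is a multiple of Y, both terms are multiples of U, and
    <X,Y> = 2/3 makes them add up to U. *)
Lemma null_direction_exists (U Y : 'cV[R]_8) : U != 0 -> Y != 0 ->
  exists X, (2^-1 * bform g X Y) *: U + bform g X U *: Y = U.
Proof.
move=> U0 Y0.
have dual W : W != 0 -> exists X, bform g X W != 0.
  move=> W0; apply/not_existsP => H; move/eqP: W0; apply.
  apply: (bform_nondeg adm) => X; rewrite (bformC adm).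
  by apply/eqP; have /negP := H X; rewrite negbK.
have [[X [XU XY]]|H] := pselect (exists X, bform g X U = 0 /\ bform g X Y != 0).
  exists ((2 / bform g X Y) *: X); rewrite !bformZl XU mulr0 scale0r addr0.
  by rewrite divfK// mulVf ?scale1r// pnatr_eq0.
have [X1 X1U] := dual U U0.
pose mu := bform g X1 Y / bform g X1 U.
have YE : Y = mu *: U.
  apply/eqP; rewrite -subr_eq0; apply/eqP/(bform_nondeg adm) => X.
  pose X' := X - (bform g X U / bform g X1 U) *: X1.
  have X'U : bform g X' U = 0 by rewrite bformBl bformZl divfK// subrr.
  have X'Y : bform g X' Y = 0.
    by apply/eqP/negPn/negP => h; apply: H; exists X'.
  rewrite (bformC adm) bformBr bformZr -X'Y bformBl bformZl /mu; field.
  exact: X1U.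
have mu0 : mu != 0 by apply: contra_neq Y0 => mu0; rewrite YE mu0 scale0r.
exists ((2 / 3 / bform g X1 Y) *: X1); rewrite !bformZl.
have X1Y : bform g X1 Y != 0.
  by rewrite YE bformZr mulf_neq0.
rewrite [X in _ + _ *: X]YE scalerA -scalerDl -[RHS]scale1r; congr (_ *: _).
by rewrite /mu; field; rewrite X1U X1Y.
Qed.

(** For Y with <Y,Y> != 0, take X = cY: then <X, J_Z Y> = 0 and the first two
    terms of [compensator_fix] add up to 3c/2 <Y,Y> J_Z Y. For null Y, the middle
    term disappears and [null_direction_exists] applies to U = J_Z Y. *)
Theorem centralizer_action (Z : 'cV[R]_(3 + 4)) (Y : 'cV[R]_8) : exists B,
  [/\ so_normalizer g V B, lie_mx B (J Z) = 0 & B *m Y = J Z *m Y].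
Proof.
suff [X XE] : exists X, compensator Z X Y *m Y = J Z *m Y.
  exists (compensator Z X Y); split=> //; last exact: compensator_lie.
  rewrite normalizer_commutator; apply: trace0_commutator.
    exact: compensator_so.
  by move=> k; exact: compensator_trace0.
have [Y0|Y0] := eqVneq (bform g Y Y) 0; last first.
  exists ((2 / 3 / bform g Y Y) *: Y); rewrite compensator_fix.
  have -> : bform g ((2 / 3 / bform g Y Y) *: Y) (J Z *m Y) = 0.
    by rewrite bformZl; have := so_form_J adm Z Y Y; rewrite (bformC adm); nra.
  rewrite scale0r addr0 bformZl -scalemxAr scalerA -scalerDl -[RHS]scale1r.
  by congr (_ *: _); field.
have [U0|U0] := eqVneq (J Z *m Y) 0.
  by exists 0; rewrite compensator_fix U0 mulmx0 !bform0l mulr0 !scaler0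
    scale0r !addr0.
have [|X XE] := null_direction_exists U0 (_ : Y != 0).
  by apply: contra_neq U0 => ->; rewrite mulmx0.
by exists X; rewrite compensator_fix Y0 scale0r addr0.
Qed.

Lemma isometric_R44 : isometric_to_Rpq 4 4 g.
Proof.
have [X X1] := unit_vector_exists adm isT.
have Pu : (frame J X : 'M[R]_8) \in unitmx.
  by rewrite -unitmx_tr -row_free_unit; exact: (frame_free adm X1).
exists (frame J X); split; last by move=> Z W; exact: (frame_isometry adm).
exists (fun W => invmx (frame J X : 'M[R]_8) *m W) => W.
- exact: (mulKmx Pu).
- exact: (mulKVmx Pu).
Qed.

(** The map C of the centre induced by B kills Z, because [B, J_Z] = 0 and J is
    injective. *)
Theorem geodesic_orbit_34 : geodesic_orbit J g.
Proof.
apply: (isotropy_geodesic_orbit adm) => Z X.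
have [B [BN BZ BX]] := centralizer_action Z X.
have [C CB] := normalizer_isotropy adm isT BN.
exists C, B; split=> //; apply: (J_inj adm isT).
by case: CB => _ _ <-.
Qed.

End Dimension8.

Theorem theorem14 (R : realType) (n : nat)
    (J : {linear 'cV[R]_(3 + 4) -> 'M[R]_n}) (g : 'M[R]_n)
    (hmin : minimal_admissible J g) :
  [/\ isometric_to_Rpq 4 4 g,
      so_normalizer g (range J) = commutator_span (range J),
      forall (Z : 'M[R]_n) (Y : 'cV[R]_n), range J Z ->
        exists B : 'M[R]_n,
          [/\ so_normalizer g (range J) B, lie_mx B Z = 0 & B *m Y = Z *m Y]
    & geodesic_orbit J g].
Proof.
have n8 := minimal_admissible_dim hmin; subst n.
have [_ adm _] := hmin; split.
- exact: isometric_R44 adm.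
- exact: normalizer_commutator adm.
- by move=> _ Y [Z _ <-]; exact: centralizer_action.
- exact: geodesic_orbit_34 adm.
Qed.
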